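(* Let $n\in\mathbb{N}$, $\alpha \in (0,n)$, $1<s<n/\alpha$ and $p \in [1,+\infty)$. (i) If $p>1$, then there exists a constant $C=C(\alpha,s,n,p)>0$ such that for every $f \in L^p(\mathrm{cap}_{\alpha,s})$ $$\int_{\mathbb{R}^{n}}\left(\mathcal{M}_{\mathrm{cap}_{\alpha,s}}f\right)^{p}d\mathrm{cap}_{\alpha,s}\leq C\int_{\mathbb{R}^{n}}|f|^{p}\,d\mathrm{cap}_{\alpha,s}.$$ (ii) If $p = 1$, then there exists a constant $C=C(\alpha,s,n)>0$ such that for every $f\in L^1(\mathrm{cap}_{\alpha,s})$ and every $t>0$ $$\mathrm{cap}_{\alpha,s}\left(\left\{x\in\mathbb{R}^{n}:\mathcal{M}_{\mathrm{cap}_{\alpha,s}}f(x)>t\right\}\right)\leq \frac{C}{t}\int_{\mathbb{R}^{n}}|f|\,d\mathrm{cap}_{\alpha,s}.$$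
   Context: For $\alpha\in(0,n)$ and $1<s<\infty$ the Riesz capacity of $E\subseteq\mathbb{R}^n$ is $\mathrm{cap}_{\alpha,s}(E)=\inf\{\|\varphi\|_{L^{s}(\mathbb{R}^{n})}^{s}:\varphi\geq 0,\ I_{\alpha}\ast\varphi\geq 1\text{ on }E\}$, where $I_{\alpha}(x)=\frac{1}{\gamma(\alpha)}\frac{1}{|x|^{n-\alpha}}$ is the Riesz kernel, with the usual normalization $\gamma(\alpha)=\pi^{n/2}2^{\alpha}\Gamma(\alpha/2)/\Gamma((n-\alpha)/2)$. For a $\mathrm{cap}_{\alpha,s}$-almost everywhere defined function $g$ with values in $[0,\infty]$, the Choquet integral is $\int_{\mathbb{R}^n} g \, d\mathrm{cap}_{\alpha,s} := \int_0^\infty \mathrm{cap}_{\alpha,s}(\{ g>t\})\,dt$, and $\int_A g\,d\mathrm{cap}_{\alpha,s}:=\int_{\mathbb{R}^n} g\chi_A\,d\mathrm{cap}_{\alpha,s}$ for $A\subseteq\mathbb{R}^n$. A function $f$ (real-valued, defined $\mathrm{cap}_{\alpha,s}$-almost everywhere) is $\mathrm{cap}_{\alpha,s}$-quasicontinuous if for every $\varepsilon>0$ there is an open set $O$ with $\mathrm{cap}_{\alpha,s}(O)<\varepsilon$ such that $f$ restricted to $\mathbb{R}^n\setminus O$ is continuous. For $0<p<\infty$, $L^p(\mathrm{cap}_{\alpha,s})$ is the set of $\mathrm{cap}_{\alpha,s}$-quasicontinuous functions $f$ with $(\int_{\mathbb{R}^n} |f|^p \, d \mathrm{cap}_{\alpha,s})^{1/p}<\infty$.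 The capacitary maximal function is $$\mathcal{M}_{\mathrm{cap}_{\alpha,s}}f(x)=\sup_{r>0}\frac{1}{\mathrm{cap}_{\alpha,s}(B(0,1))r^{n-\alpha s}}\int_{B(x,r)}|f|\,d\mathrm{cap}_{\alpha,s},$$ where $B(x,r)$ is the open ball with center $x$ and radius $r$. *)

(* Defs.v *)
From HB Require Import structures.
From mathcomp Require Import all_boot all_order all_algebra.
From mathcomp Require Import all_classical all_reals all_analysis.

Set Implicit Arguments.
Unset Strict Implicit.
Unset Printing Implicit Defensive.
Import Order.TTheory GRing.Theory Num.Theory.
Import numFieldNormedType.Exports.

Local Open Scope classical_set_scope.
Local Open Scope ring_scope.

(* R^n is 'rV[R]_n. Its canonical norm is the sup norm, which has the right
   open sets but not the right balls, hence [enorm] and [eball]. *)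
Section euclidean.
Context {R : realType} {n : nat}.

Definition enorm (x : 'rV[R]_n) : R := Num.sqrt (\sum_(i < n) x ord0 i ^+ 2).

Definition eball (x : 'rV[R]_n) (r : R) : set 'rV[R]_n :=
  [set y | enorm (y - x) < r].

End euclidean.

(* The Borel sigma-algebra of R^n, generated by the coordinate maps as the
   library does for [n.-tuple R]. *)
Definition rV_display : measure_display -> measure_display.
Proof. exact. Qed.

Section measurable_rV.
Context {R : realType} (n : nat).

Let coord (i : 'I_n) (v : 'rV[R]_n) : R := v ord0 i.

Let rV_set0 : g_sigma_preimage coord set0.
Proof. exact: sigma_algebra0. Qed.

Let rV_setC A : g_sigma_preimage coord A -> g_sigma_preimage coord (~` A).
Proof. exact: sigma_algebraC. Qed.

Let rV_bigcup (F : _^nat) : (forall i, g_sigma_preimage coord (F i)) ->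
  g_sigma_preimage coord (\bigcup_i (F i)).
Proof. exact: sigma_algebra_bigcup. Qed.

HB.instance Definition _ :=
  @isMeasurable.Build (rV_display default_measure_display) 'rV[R]_n
    (g_sigma_preimage coord) rV_set0 rV_setC rV_bigcup.

End measurable_rV.

Section lebesgue_rV.
Context {R : realType}.

Lemma measurable_coord_rV n (i : 'I_n) :
  measurable_fun [set: 'rV[R]_n] (fun v => v ord0 i).
Proof.
move=> _ Y mY; rewrite setTI; apply: sub_sigma_algebra => /=.
rewrite -bigcup_seq/=; exists i => /=; first by rewrite mem_index_enum.
by exists Y => //; rewrite setTI.
Qed.

Lemma measurable_fun_rV d (T : measurableType d) n (f : T -> 'rV[R]_n) :
  (forall i, measurable_fun [set: T] (fun x => f x ord0 i)) ->
  measurable_fun [set: T] f.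
Proof.
move=> mf _ A mA; rewrite setTI.
suff : g_sigma_preimage (fun (i : 'I_n) (v : 'rV[R]_n) => v ord0 i) `<=`
    [set B | measurable (f @^-1` B)] by apply.
apply: smallest_sub => [|B].
  split=> [|B /= mB|F /= mF].
  - by rewrite /= preimage_set0.
  - by rewrite setTD preimage_setC; exact: measurableC.
  - by rewrite preimage_bigcup; exact: bigcup_measurable.
rewrite -bigcup_seq => -[i _ [Y mY <-]] /=.
by rewrite setTI -comp_preimage -[X in measurable X]setTI; exact: mf.
Qed.

Definition cons_rV n (x : R * 'rV[R]_n) : 'rV[R]_n.+1 :=
  row_mx (const_mx x.1 : 'M[R]_1) x.2.

Definition uncons_rV n (v : 'rV[R]_n.+1) : R * 'rV[R]_n :=
  (v ord0 ord0, rsubmx (v : 'rV_(1 + n))).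

Lemma cons_rV_ord0 n x : @cons_rV n x ord0 ord0 = x.1.
Proof.
rewrite /cons_rV (_ : ord0 = lshift n (ord0 : 'I_1)); last exact/val_inj.
by rewrite (@row_mxEl _ 1 1 n) mxE.
Qed.

Lemma cons_rV_lift n x (j : 'I_n) : @cons_rV n x ord0 (lift ord0 j) = x.2 ord0 j.
Proof.
rewrite /cons_rV (_ : lift ord0 j = rshift 1 j); last exact/val_inj.
exact: (@row_mxEr _ 1 1 n).
Qed.

Lemma measurable_cons_rV n : measurable_fun setT (@cons_rV n).
Proof.
apply: measurable_fun_rV => i; case: (unliftP ord0 i) => [j|] ->; last first.
  by under eq_fun do rewrite cons_rV_ord0; exact: measurable_fst.
under eq_fun do rewrite cons_rV_lift.
apply: (@measurableT_comp _ _ _ _ _ _ (fun v : 'rV[R]_n => v ord0 j)).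
  exact: measurable_coord_rV.
exact: measurable_snd.
Qed.

Lemma measurable_uncons_rV n : measurable_fun setT (@uncons_rV n).
Proof.
apply: measurable_fun_pair; first exact: measurable_coord_rV.
apply: measurable_fun_rV => i.
under eq_fun do rewrite mxE.
exact: measurable_coord_rV.
Qed.

Lemma cons_rVK n : cancel (@cons_rV n) (@uncons_rV n).
Proof.
move=> [x v]; rewrite /uncons_rV; congr (_, _); last exact: row_mxKr.
exact: cons_rV_ord0.
Qed.

(* Lebesgue measure on R^n.+1 as the image of the product of the Lebesgue
   measure on R and a measure [m] on R^n. *)
Definition lebesgue_cons n (m : {sigma_finite_measure set 'rV[R]_n -> \bar R})
    (A : set 'rV[R]_n.+1) : \bar R :=
  (@lebesgue_measure R \x m)%E (@cons_rV n @^-1` A).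

Section lebesgue_cons.
Variables (n : nat) (m : {sigma_finite_measure set 'rV[R]_n -> \bar R}).

Let mpre (A : set 'rV[R]_n.+1) : measurable A ->
  measurable (@cons_rV n @^-1` A).
Proof.
by move=> mA; rewrite -[X in measurable X]setTI; exact: measurable_cons_rV.
Qed.

Let lebesgue_cons0 : lebesgue_cons m set0 = 0%E.
Proof. by rewrite /lebesgue_cons preimage_set0 measure0. Qed.

Let lebesgue_cons_ge0 A : (0 <= lebesgue_cons m A)%E.
Proof. exact: measure_ge0. Qed.

Let lebesgue_cons_sigma_additive : semi_sigma_additive (lebesgue_cons m).
Proof.
move=> F mF tF mUF; rewrite /lebesgue_cons preimage_bigcup.
apply: measure_semi_sigma_additive.
- by move=> k; exact: mpre.
- apply/trivIsetP => /= i j _ _ ij; rewrite -preimage_setI.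
  by move/trivIsetP : tF => /(_ _ _ _ _ ij) ->//; rewrite preimage_set0.
- by rewrite -preimage_bigcup; exact: mpre.
Qed.

HB.instance Definition _ := isMeasure.Build _ _ _ (lebesgue_cons m)
  lebesgue_cons0 lebesgue_cons_ge0 lebesgue_cons_sigma_additive.

Let lebesgue_cons_sigma_finite : sigma_finite setT (lebesgue_cons m).
Proof.
have /sigma_finiteP[F [TF ndF Foo]] := sigma_finiteT (@lebesgue_measure R).
have /sigma_finiteP[G [TG ndG Goo]] := sigma_finiteT m.
exists (fun k => @uncons_rV n @^-1` (F k `*` G k)).
  apply/esym/seteqP; split => // v _.
  have [i _ Fi] : (\bigcup_i F i) (uncons_rV v).1 by rewrite -TF.
  have [j _ Gj] : (\bigcup_i G i) (uncons_rV v).2 by rewrite -TG.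
  exists (maxn i j) => //; split.
  - by move: Fi; exact/subsetPset/ndF/leq_maxl.
  - by move: Gj; exact/subsetPset/ndG/leq_maxr.
move=> k; have [mF Fk] := Foo k; have [mG Gk] := Goo k; split.
  rewrite -[X in measurable X]setTI; apply: measurable_uncons_rV => //.
  exact: measurableX.
rewrite /lebesgue_cons -comp_preimage (_ : _ \o _ = id); last first.
  by apply/funext => x /=; exact: cons_rVK.
by rewrite preimage_id product_measure1E// lte_mul_pinfty// ge0_fin_numE.
Qed.

HB.instance Definition _ := Measure_isSigmaFinite.Build _ _ _ (lebesgue_cons m)
  lebesgue_cons_sigma_finite.

End lebesgue_cons.

Fixpoint lebesgue_rV n : {sigma_finite_measure set 'rV[R]_n -> \bar R} :=
  if n is k.+1 then lebesgue_cons (lebesgue_rV k) else \d_(0 : 'rV[R]_0).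

(* [lebesgue_rV n] is Lebesgue measure: it gives every measurable box the
   product of the measures of its sides. *)
Lemma lebesgue_rV_box n (B : 'I_n -> set R) : (forall i, measurable (B i)) ->
  lebesgue_rV n [set v | forall i, B i (v ord0 i)] =
  (\prod_(i < n) lebesgue_measure (B i))%E.
Proof.
elim: n B => [|n IHn] B mB.
  by rewrite big_ord0 /= diracE mem_set// => -[].
rewrite big_ord_recl -IHn; last by move=> i; exact: mB.
have mB' : measurable [set v : 'rV[R]_n | forall i, B (lift ord0 i) (v ord0 i)].
  rewrite [X in measurable X](_ : _ = \bigcap_(i in [set: 'I_n])
      ((fun v : 'rV[R]_n => v ord0 i) @^-1` B (lift ord0 i))); last first.
    by apply/seteqP; split => [v Bv i _|v Bv i]; [exact: Bv|exact: (Bv i)].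
  apply: fin_bigcap_measurable => // i _.
  by rewrite -[X in measurable X]setTI; exact: measurable_coord_rV.
rewrite /= -product_measure1E//; last exact: mB.
rewrite /lebesgue_cons; congr product_measure1.
apply/seteqP; split => -[x v] /=.
  move=> Bxv; split.
    by move: (Bxv ord0); rewrite cons_rV_ord0.
  by move=> i /=; move: (Bxv (lift ord0 i)); rewrite cons_rV_lift.
move=> [/= Bx Bv] i.
by case: (unliftP ord0 i) => [j|] ->; rewrite ?cons_rV_ord0 ?cons_rV_lift.
Qed.

End lebesgue_rV.

Section capacity.
Context {R : realType} (n : nat).
Implicit Types (alpha s p : R) (x y : 'rV[R]_n) (E D : set 'rV[R]_n).
Local Open Scope ereal_scope.

Definition Gamma (z : R) : R :=
  (\int[lebesgue_measure]_(t in `]0, +oo[) (t `^ (z - 1) * expR (- t)))%R.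

Definition riesz_gamma alpha : R :=
  (pi `^ (n%:R / 2) * 2 `^ alpha * Gamma (alpha / 2)
    / Gamma ((n%:R - alpha) / 2))%R.

(* [inve 0 = +oo], so the kernel is [+oo] at the origin when [alpha < n]. *)
Definition riesz_kernel alpha x : \bar R :=
  (riesz_gamma alpha)^-1%:E * ((enorm x `^ (n%:R - alpha))%:E)^-1.

Definition riesz_potential alpha (phi : 'rV[R]_n -> R) x : \bar R :=
  \int[lebesgue_rV n]_y (riesz_kernel alpha (x - y)%R * (phi y)%:E).

Definition riesz_cap alpha s E : \bar R :=
  ereal_inf [set 'N[lebesgue_rV n]_(s%:E)[EFin \o phi] `^ s | phi in
    [set phi : 'rV[R]_n -> R | [/\ measurable_fun setT phi,
      (forall x, 0 <= phi x)%R &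
      (forall x, E x -> 1 <= riesz_potential alpha phi x)]]].

(* A quasi-everywhere defined function is encoded by a total function [g]
   together with its domain [D], a set whose complement has capacity zero; the
   values of [g] outside [D] are never used. *)
Definition choquet (c : set 'rV[R]_n -> \bar R) D (g : 'rV[R]_n -> \bar R) :
    \bar R :=
  \int[lebesgue_measure]_(t in `]0%R, +oo[) c [set x | D x /\ t%:E < g x].

Definition choquet_on c D E (g : 'rV[R]_n -> \bar R) : \bar R :=
  choquet c D (fun x => g x * (\1_E x)%:E).

Definition quasicontinuous alpha s D (f : 'rV[R]_n -> R) : Prop :=
  forall eps : R, (0 < eps)%R -> exists O : set 'rV[R]_n,
    [/\ open O, riesz_cap alpha s O < eps%:E & {within D `\` O, continuous f}].

Definition Lp_cap alpha s p D (f : 'rV[R]_n -> R) : Prop :=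
  [/\ riesz_cap alpha s (~` D) = 0, quasicontinuous alpha s D f &
    choquet (riesz_cap alpha s) D (fun x => (`|f x| `^ p)%:E) `^ p^-1 < +oo].

Definition cap_maximal alpha s D (f : 'rV[R]_n -> R) x : \bar R :=
  ereal_sup [set
    (riesz_cap alpha s (eball 0 1) * (r `^ (n%:R - alpha * s))%:E)^-1
      * choquet_on (riesz_cap alpha s) D (eball x r) (fun y => `|f y|%:E)
    | r in [set r : R | (0 < r)%R]].

End capacity.

(* Main.v *)
(* Let c be the Riesz capacity and d = n - alpha s, so that c (B (x, r)) <= K r^d
   by scaling. Fix t > 0, let E_k be the set where |f| exceeds 2^k theta t, and
   let phi_k be nearly optimal for c (E_k). If M f (x) > t, there is a ball
   B = B (x, r) with t r^d <~ sum_k 2^k theta t c (E_k /\ B), since the levels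
   below theta t contribute at most half. Split each phi_k at the cube of radius
   2 r. The potential of the far part is comparable at all points of B, so
   either I_alpha phi_k (x) is bounded below for some k, and these x form a set
   of capacity <~ sum_k ||phi_k||^s, or the near parts are admissible up to a
   factor 2 and t r^d <~ nu (2 B) for the measure nu of density
   sum_k 2^k theta t phi_k^s. The latter x are controlled by covering with
   disjoint dyadic cubes. Hence
     c (M f > t) <= (C / t) sum_k 2^k theta t c (|f| > 2^k theta t),
   which gives the weak type bound at once and, integrated in t, the strong one. *)
Require Import Defs.
From HB Require Import structures.
From mathcomp Require Import all_boot all_order all_algebra.
From mathcomp Require Import all_classical all_reals all_analysis.
From mathcomp Require Import measurable_realfun zify ring lra.
Set Implicit Arguments.
Unset Strict Implicit.
Unset Printing Implicit Defensive.
Import Order.TTheory GRing.Theory Num.Theory.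
Import numFieldNormedType.Exports.
Local Open Scope classical_set_scope.
Local Open Scope ring_scope.

(** * Affine changes of variables *)

Section scaled_image.
Context d1 d2 (T1 : measurableType d1) (T2 : measurableType d2) (R : realType).
Local Open Scope ereal_scope.

(** With [f] affine and [a] its Jacobian, this turns out to be Lebesgue measure again, which gives
    the changes of variables. *)
Definition scaled_image (a : {nonneg R}) (m : {measure set T1 -> \bar R})
    (f : T1 -> T2) (mf : measurable_fun [set: T1] f) :
    {measure set T2 -> \bar R} :=
  mscale a
    (measure_function_pushforward__canonical__measure_function_Measure m mf).

Lemma scaled_imageE a m f mf A :
  @scaled_image a m f mf A = a%:num%:E * m (f @^-1` A).
Proof. by []. Qed.

Lemma integral_scaled_image a m f mf (g : T2 -> \bar R) :
  measurable_fun setT g -> (forall x, 0 <= g x) ->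
  \int[@scaled_image a m f mf]_x g x = a%:num%:E * \int[m]_x g (f x).
Proof.
move=> mg g0; rewrite ge0_integral_mscale//.
by rewrite ge0_integral_pushforward.
Qed.

End scaled_image.
Arguments scaled_image {d1 d2 T1 T2 R} a m {f} mf.

Section affine_change_of_variables.
Context {R : realType}.
Local Open Scope ereal_scope.

Lemma measurable_affine (a b : R) :
  measurable_fun [set: R] (fun x : R => a * x + b)%R.
Proof. by apply: measurable_funD => //; exact: measurable_funM. Qed.

(** By uniqueness of Lebesgue measure it suffices to compare the two measures on half-open
    intervals. *)
Lemma lebesgue_measure_affine (a b : R) (A : set R) : (0 < a)%R ->
  measurable A ->
  lebesgue_measure A =
  a%:E * lebesgue_measure ((fun x : R => a * x + b)%R @^-1` A).
Proof.
move=> a0 mA.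
have mf : measurable_fun [set: measurableTypeR R]
    ((fun x => a * x + b)%R : measurableTypeR R -> measurableTypeR R).
  exact: measurable_affine.
pose m := scaled_image (NngNum (ltW a0)) lebesgue_measure mf.
rewrite -[RHS]/(m A).
apply: (@lebesgue_measure_unique R m) => // X [[u v] _ <-].
rewrite [RHS]scaled_imageE/=.
rewrite (_ : _ @^-1` _ = `](u - b) / a, (v - b) / a]%classic)%R; last first.
  by apply/seteqP; split => x /=; rewrite !in_itv/= ltr_pdivrMr// ler_pdivlMr//
    ltrBlDr lerBrDr mulrC.
rewrite !lebesgue_measure_itv/= !lte_fin ltr_pM2r ?invr_gt0// ltrD2r.
case: ifPn => uv; last by rewrite mule0.
by rewrite -!EFinB -EFinM; congr EFin; field; rewrite gt_eqF.
Qed.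

(** Positive dilations preserve the half-line; this rescales the levels in a Choquet integral. *)
Lemma ge0_integral_itv0y_scale (a : R) (h : R -> \bar R) : (0 < a)%R ->
  (forall x, 0 <= h x) -> measurable_fun setT h ->
  \int[lebesgue_measure]_(x in `]0%R, +oo[) h x =
  a%:E * \int[lebesgue_measure]_(x in `]0%R, +oo[) h (a * x)%R.
Proof.
move=> a0 h0 mh.
have mf : measurable_fun [set: measurableTypeR R]
    ((fun x => a * x + 0)%R : measurableTypeR R -> measurableTypeR R).
  exact: measurable_affine.
pose m := scaled_image (NngNum (ltW a0)) lebesgue_measure mf.
have mE (A : set R) : measurable A -> lebesgue_measure A = m A.
  exact: lebesgue_measure_affine.
rewrite [LHS]integral_mkcond [X in _ * X]integral_mkcond.
transitivity (\int[m]_x (h \_ `]0%R, +oo[) x).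
  by apply: (eq_measure_integral m) => A mA _; exact: mE.
rewrite integral_scaled_image; last 2 first.
- by apply/(measurable_restrictT _ _).1 => //; exact: measurable_funTS.
- by move=> x; exact: erestrict_ge0.
congr (_ * _); apply: eq_integral => x _.
by rewrite /patch addr0 !mem_setE !in_itv/= !andbT pmulr_rgt0.
Qed.

Variable n : nat.
Local Notation V := 'rV[R]_n.

Let box (B : 'I_n -> set R) : set V := [set v | forall i, B i (v ord0 i)].

Let boxes : set (set V) :=
  [set box B | B in [set B | forall i, measurable (B i)]].

Let measurable_box B : (forall i, measurable (B i)) -> measurable (box B).
Proof.
move=> mB; rewrite (_ : box B =
    \bigcap_(i in [set: 'I_n]) ((fun v : V => v ord0 i) @^-1` B i)); last first.
  by apply/seteqP; split => [v Bv i _|v Bv i]; [exact: Bv|exact: (Bv i)].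
apply: fin_bigcap_measurable => // i _.
by rewrite -[X in measurable X]setTI; exact: measurable_coord_rV.
Qed.

Let measurable_boxes : measurable = <<s boxes >>.
Proof.
apply/seteqP; split.
  apply: smallest_sub; first exact: smallest_sigma_algebra.
  rewrite -bigcup_seq => _ [i _ [Y mY <-]]; apply: sub_sigma_algebra.
  exists (fun j => if j == i then Y else setT) => /=.
    by move=> j; case: ifP.
  apply/seteqP; split => [v /(_ i)/=|v /= [_ Yv] j]; first by rewrite eqxx.
  by case: eqP => // ->.
apply: smallest_sub; first exact: sigma_algebra_measurable.
by move=> _ [B mB <-]; exact: measurable_box.
Qed.

Let setI_boxes : setI_closed boxes.
Proof.
move=> _ _ [A mA <-] [B mB <-]; exists (fun i => A i `&` B i) => /=.
  by move=> i; exact: measurableI.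
apply/seteqP; split=> [v AB|v [Av Bv] i]; last by split.
by split => i; have [] := AB i.
Qed.

Lemma measurable_affine_rV (a : R) (b : V) :
  measurable_fun [set: V] (fun x : V => a *: x + b)%R.
Proof.
apply: measurable_fun_rV => i; under eq_fun do rewrite !mxE.
apply: (@measurableT_comp _ _ _ _ _ _ (fun x : R => a * x + b ord0 i)%R).
  exact: measurable_affine.
exact: measurable_coord_rV.
Qed.

(** Both sides are measures that agree on boxes. Boxes are closed under intersection, generate the
    sigma-algebra, and countably many of finite measure exhaust the space. *)
Lemma lebesgue_rV_affine (a : R) (b : V) (A : set V) : (0 < a)%R ->
  measurable A ->
  lebesgue_rV n A =
  (a ^+ n)%:E * lebesgue_rV n ((fun x : V => a *: x + b)%R @^-1` A).
Proof.
move=> a0 mA.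
have an0 : (0 <= a ^+ n)%R by rewrite exprn_ge0// ltW.
pose m := scaled_image (NngNum an0) (lebesgue_rV n) (measurable_affine_rV a b).
rewrite -[RHS]/(m A).
apply: (measure_unique boxes (fun k => box (fun=> `](- k%:R)%R, k%:R%R[%classic))) => //.
- by move=> k; exists (fun=> `](- k%:R)%R, k%:R%R[%classic).
- apply/seteqP; split => // v _.
  pose M := (\sum_(i < n) `|v ord0 i|)%R.
  exists (Num.truncn M).+1 => // i /=; rewrite in_itv/= -ltr_norml.
  apply: le_lt_trans (truncnS_gt M).
  by rewrite /M (bigD1 i)//= lerDl sumr_ge0.
- move=> _ [B mB <-]; rewrite [RHS]scaled_imageE/= /box lebesgue_rV_box//.
  transitivity ((a ^+ n)%:E * lebesgue_rV n
      [set v : V | forall i, ((fun x : R => a * x + b ord0 i)%R @^-1` B i) (v ord0 i)]).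
    rewrite (lebesgue_rV_box
      (B := fun i => (fun x : R => a * x + b ord0 i)%R @^-1` B i)); last first.
      by move=> i; rewrite -[X in measurable X]setTI; exact: measurable_affine.
    rewrite (eq_bigr _ (fun i _ => lebesgue_measure_affine (b ord0 i) a0 (mB i))).
    rewrite big_split/=; congr (_ * _).
    by rewrite prodEFin prodr_const card_ord.
  congr (_ * lebesgue_rV n _).
  by apply/seteqP; split => v /= Bv i; move: (Bv i); rewrite !mxE.
- move=> k; pose B (i : 'I_n) : set R := `](- k%:R)%R, k%:R%R[%classic.
  suff : \prod_(i < n) lebesgue_measure (B i) < +oo.
    by rewrite -(lebesgue_rV_box (B := B))// => i; exact: measurable_itv.
  rewrite (eq_bigr (fun=> (k%:R + k%:R)%:E)) ?prodEFin ?ltry// => i _.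
  rewrite /B lebesgue_measure_itv/= lte_fin; case: ifPn => [_|].
    by rewrite -EFinB opprK.
  rewrite -leNgt => kk; have k0 := ler0n R k.
  by congr EFin; lra.
Qed.

Lemma ge0_integral_lebesgue_rV_affine (a : R) (b : V) (h : V -> \bar R) :
  (0 < a)%R -> (forall x, 0 <= h x) -> measurable_fun setT h ->
  \int[lebesgue_rV n]_x h x =
  (a ^+ n)%:E * \int[lebesgue_rV n]_x h (a *: x + b)%R.
Proof.
move=> a0 h0 mh.
have an0 : (0 <= a ^+ n)%R by rewrite exprn_ge0// ltW.
pose m := scaled_image (NngNum an0) (lebesgue_rV n) (measurable_affine_rV a b).
transitivity (\int[m]_x h x); last by rewrite integral_scaled_image.
by apply: eq_measure_integral => A mA _; exact: lebesgue_rV_affine.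
Qed.

End affine_change_of_variables.

(** * The Euclidean norm and its coordinates *)

Section euclidean_norm.
Context {R : realType} {n : nat}.
Implicit Types x y : 'rV[R]_n.

Lemma enorm_ge0 x : 0 <= enorm x.
Proof. exact: sqrtr_ge0. Qed.

Lemma enormZ (a : R) x : 0 <= a -> enorm (a *: x) = a * enorm x.
Proof.
move=> a0; rewrite /enorm (eq_bigr (fun i => a ^+ 2 * x ord0 i ^+ 2)).
  by rewrite -mulr_sumr sqrtrM ?sqr_ge0// sqrtr_sqr ger0_norm.
by move=> i _; rewrite mxE exprMn.
Qed.

Lemma ler_coord_enorm x i : `|x ord0 i| <= enorm x.
Proof.
rewrite -sqrtr_sqr /enorm ler_wsqrtr// (bigD1 i)//= lerDl sumr_ge0// => j _.
exact: sqr_ge0.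
Qed.

Lemma enorm_le_coord x (r : R) : 0 <= r -> (forall i, `|x ord0 i| <= r) ->
  enorm x <= n%:R * r.
Proof.
move=> r0 xr; rewrite -(ler_sqr (enorm_ge0 x)) ?nnegrE ?mulr_ge0// sqr_sqrtr; last first.
  by apply: sumr_ge0 => i _; exact: sqr_ge0.
apply: (@le_trans _ _ (\sum_(i < n) r ^+ 2)).
  apply: ler_sum => i _; rewrite -[leLHS]real_normK ?num_real//.
  by rewrite ler_sqr ?nnegrE.
rewrite sumr_const card_ord -[leLHS]mulr_natl exprMn ler_wpM2r ?sqr_ge0//.
by rewrite -natrX ler_nat; case: (n) => // k; rewrite leq_pmulr.
Qed.

Lemma measurable_enorm : measurable_fun [set: 'rV[R]_n] (@enorm R n).
Proof.
have -> : @enorm R n = fun x => (\sum_(i < n) x ord0 i ^+ 2) `^ 2^-1.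
  by apply/funext => x; rewrite powR12_sqrt// sumr_ge0// => i _; exact: sqr_ge0.
apply: (@measurableT_comp _ _ _ _ _ _ (@powR R ^~ 2^-1)) => //.
apply: measurable_sum => i; apply: measurable_funX.
exact: measurable_coord_rV.
Qed.

Lemma measurable_reflect (x : 'rV[R]_n) :
  measurable_fun [set: 'rV[R]_n] (fun y => x - y).
Proof.
under eq_fun do rewrite addrC -scaleN1r; exact: measurable_affine_rV.
Qed.

End euclidean_norm.

(** * Riesz potentials *)

Section riesz_potential.
Context {R : realType} {n : nat}.
Variable alpha : R.
Hypothesis alpha_ltn : alpha < n%:R.
Implicit Types x y : 'rV[R]_n.
Local Open Scope ereal_scope.
Local Notation ker := (@riesz_kernel R n alpha).
Local Notation pot := (@riesz_potential R n alpha).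

Lemma inv_riesz_gamma_ge0 : (0 <= (riesz_gamma n alpha)^-1)%R.
Proof.
have Gamma_ge0 z : (0 <= @Gamma R z)%R.
  by apply: Rintegral_ge0 => x _; rewrite mulr_ge0 ?powR_ge0 ?expR_ge0.
by rewrite invr_ge0 /riesz_gamma divr_ge0// mulr_ge0// mulr_ge0 ?powR_ge0.
Qed.

Lemma riesz_kernel_ge0 x : 0 <= ker x.
Proof.
by rewrite /riesz_kernel mule_ge0 ?lee_fin ?inv_riesz_gamma_ge0// inve_ge0 lee_fin powR_ge0.
Qed.

Lemma riesz_kernelZ (a : R) x : (0 < a)%R ->
  ker (a *: x)%R = (a `^ (alpha - n%:R))%:E * ker x.
Proof.
move=> a0; rewrite /riesz_kernel enormZ ?ltW// muleCA; congr (_ * _).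
rewrite powRM ?enorm_ge0 ?ltW// -[(alpha - _)%R]opprB powRN.
have a0' : (a `^ (n%:R - alpha) != 0)%R by rewrite gt_eqF// powR_gt0.
rewrite !inver mulf_eq0 (negbTE a0')/=; case: ifPn => [_|e0].
  by rewrite gt0_muley// lte_fin invr_gt0 powR_gt0.
by rewrite -EFinM invfM.
Qed.

(** The kernel decreases with the norm because [alpha < n], and homogeneity turns the factor [a]
    into a power. *)
Lemma riesz_kernel_le (a : R) x y : (0 < a)%R -> (enorm x <= a * enorm y)%R ->
  (a `^ (alpha - n%:R))%:E * ker y <= ker x.
Proof.
move=> a0 xy; rewrite -riesz_kernelZ// /riesz_kernel enormZ ?(ltW a0)//.
apply: lee_wpmul2l; first by rewrite lee_fin inv_riesz_gamma_ge0.
rewrite lee_pV2 ?inE ?lee_fin ?powR_ge0//.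
have a0' := ltW a0; have na := ltW alpha_ltn.
by apply: ge0_ler_powR; rewrite ?nnegrE ?subr_ge0 ?enorm_ge0// mulr_ge0 ?enorm_ge0.
Qed.

Lemma measurable_riesz_kernel : measurable_fun [set: 'rV[R]_n] ker.
Proof.
(* The origin is split off: the kernel is [+oo] there, whereas a real power of [0] with negative
   exponent has the default value [0]. *)
have -> : ker = fun x => ((riesz_gamma n alpha)^-1)%:E *
    (if (enorm x == 0)%R then +oo else (enorm x `^ (alpha - n%:R))%:E).
  apply/funext => x; rewrite /riesz_kernel; congr (_ * _).
  rewrite inver powR_eq0 subr_eq0 (gt_eqF alpha_ltn) andbT; case: ifPn => // e0.
  by rewrite -[(alpha - _)%R]opprB powRN.
apply: measurable_funeM; apply: measurable_fun_ifT => //.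
  by apply: measurable_fun_eqr => //; exact: measurable_enorm.
apply/measurable_EFinP.
apply: (@measurableT_comp _ _ _ _ _ _ (fun r : R => r `^ (alpha - n%:R))%R) => //.
exact: measurable_enorm.
Qed.

Lemma measurable_riesz_integrand (phi : 'rV[R]_n -> R) x :
  measurable_fun setT phi ->
  measurable_fun setT (fun y => ker (x - y)%R * (phi y)%:E).
Proof.
move=> mphi; apply: emeasurable_funM; last exact/measurable_EFinP.
apply: (@measurableT_comp _ _ _ _ _ _ ker); first exact: measurable_riesz_kernel.
exact: measurable_reflect.
Qed.

Lemma riesz_potential_ge0 (phi : 'rV[R]_n -> R) x :
  (forall y, 0 <= phi y)%R -> 0 <= pot phi x.
Proof.
by move=> phi0; apply: integral_ge0 => y _; rewrite mule_ge0 ?riesz_kernel_ge0 ?lee_fin.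
Qed.

(** Domination almost everywhere is what the test function for a countable union provides. *)
Lemma ae_le_riesz_potential (phi psi : 'rV[R]_n -> R) x :
  measurable_fun setT phi -> measurable_fun setT psi ->
  (forall y, 0 <= phi y)%R -> (forall y, 0 <= psi y)%R ->
  {ae lebesgue_rV n, forall y, (phi y <= psi y)%R} -> pot phi x <= pot psi x.
Proof.
move=> mphi mpsi phi0 psi0 le; apply: ae_ge0_le_integral => //.
- by move=> y _; rewrite mule_ge0 ?riesz_kernel_ge0 ?lee_fin.
- exact: measurable_riesz_integrand.
- by move=> y _; rewrite mule_ge0 ?riesz_kernel_ge0 ?lee_fin.
- exact: measurable_riesz_integrand.
- move: le; apply: filterS => y le _.
  by apply: lee_wpmul2l; rewrite ?riesz_kernel_ge0 ?lee_fin.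
Qed.

Lemma riesz_potentialZ (a : R) (phi : 'rV[R]_n -> R) x : (0 <= a)%R ->
  measurable_fun setT phi -> (forall y, 0 <= phi y)%R ->
  pot (fun y => a * phi y)%R x = a%:E * pot phi x.
Proof.
move=> a0 mphi phi0; rewrite -ge0_integralZl//.
- by apply: eq_integral => y _; rewrite EFinM muleCA.
- exact: measurable_riesz_integrand.
- by move=> y _; rewrite mule_ge0 ?riesz_kernel_ge0 ?lee_fin.
Qed.

Lemma riesz_potentialD (phi psi : 'rV[R]_n -> R) x :
  measurable_fun setT phi -> measurable_fun setT psi ->
  (forall y, 0 <= phi y)%R -> (forall y, 0 <= psi y)%R ->
  pot (fun y => phi y + psi y)%R x = pot phi x + pot psi x.
Proof.
move=> mphi mpsi phi0 psi0; rewrite -ge0_integralD//.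
- by apply: eq_integral => y _; rewrite EFinD ge0_muleDr// lee_fin.
- by move=> y _; rewrite mule_ge0 ?riesz_kernel_ge0 ?lee_fin.
- exact: measurable_riesz_integrand.
- by move=> y _; rewrite mule_ge0 ?riesz_kernel_ge0 ?lee_fin.
- exact: measurable_riesz_integrand.
Qed.

(** In the substitution, the Jacobian (exponent [n]) and the homogeneity of the kernel (exponent
    [alpha - n]) combine to the exponent [alpha]. *)
Lemma riesz_potential_affine (a : R) (b : 'rV[R]_n) (phi : 'rV[R]_n -> R) x :
  (0 < a)%R -> measurable_fun setT phi -> (forall y, 0 <= phi y)%R ->
  pot (fun y => a `^ alpha * phi (a *: y + b))%R x = pot phi (a *: x + b)%R.
Proof.
move=> a0 mphi phi0; rewrite [RHS](ge0_integral_lebesgue_rV_affine b a0)//; last 2 first.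
- by move=> y; rewrite mule_ge0 ?riesz_kernel_ge0 ?lee_fin.
- exact: measurable_riesz_integrand.
have mphi' : measurable_fun setT (fun y => phi (a *: y + b)%R).
  by apply: (measurableT_comp mphi); exact: measurable_affine_rV.
rewrite -ge0_integralZl//; last 3 first.
- have mH := measurable_riesz_integrand (a *: x + b)%R mphi.
  exact: (measurableT_comp mH (measurable_affine_rV a b)).
- by move=> y _; rewrite mule_ge0 ?riesz_kernel_ge0 ?lee_fin.
- by rewrite lee_fin exprn_ge0// ltW.
apply: eq_integral => y _.
rewrite opprD addrACA subrr addr0 -scalerBr riesz_kernelZ//.
rewrite EFinM; move: (ker _) (phi _)%:E => k q.
rewrite muleCA [RHS]muleA [in RHS]muleA -muleA; congr (_ * _).
rewrite -EFinM -powR_mulrn ?ltW// -powRD; last by rewrite (gt_eqF a0) implybT.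
by rewrite addrC subrK.
Qed.

End riesz_potential.

(** * Riesz capacity *)

Section riesz_capacity.
Context {R : realType} {n : nat}.
Variables alpha s : R.
Hypotheses (alpha_ltn : alpha < n%:R) (s_gt0 : 0 < s).
Implicit Types (x y : 'rV[R]_n) (E : set 'rV[R]_n) (phi : 'rV[R]_n -> R).
Local Open Scope ereal_scope.
Local Notation pot := (@riesz_potential R n alpha).
Local Notation cap := (@riesz_cap R n alpha s).

Definition energy phi : \bar R := \int[lebesgue_rV n]_y (phi y `^ s)%:E.

Definition admissible E phi : Prop := [/\ measurable_fun setT phi,
  (forall x, 0 <= phi x)%R & forall x, E x -> 1 <= pot phi x].

Lemma energy_ge0 phi : 0 <= energy phi.
Proof. by apply: integral_ge0 => y _; rewrite lee_fin powR_ge0. Qed.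

Lemma measurable_powR_EFin phi :
  measurable_fun setT phi -> measurable_fun setT (fun y => (phi y `^ s)%:E).
Proof.
move=> mphi; apply/measurable_EFinP.
exact: (@measurableT_comp _ _ _ _ _ _ (fun r : R => r `^ s)%R).
Qed.

Lemma riesz_capE E : cap E = ereal_inf [set energy phi | phi in admissible E].
Proof.
congr ereal_inf; apply/seteqP; split => _ [phi [mphi phi0 Ephi] <-];
  exists phi => //; rewrite poweR_Lnorm ?gt_eqF//; apply: eq_integral => y _ /=;
  by rewrite ger0_norm.
Qed.

Lemma riesz_cap_le_energy E phi : admissible E phi -> cap E <= energy phi.
Proof. by move=> Ephi; rewrite riesz_capE; apply: ereal_inf_lbound; exists phi. Qed.

Lemma riesz_cap_ge0 E : 0 <= cap E.
Proof.
by rewrite riesz_capE; apply: le_ereal_inf_tmp => _ [phi _ <-]; exact: energy_ge0.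
Qed.

Lemma riesz_cap_approx E (e : R) : (0 < e)%R -> cap E < +oo ->
  exists2 phi, admissible E phi & energy phi <= cap E + e%:E.
Proof.
move=> e0 Eoo; have Efin : cap E \is a fin_num by rewrite ge0_fin_numE// riesz_cap_ge0.
move: Efin; rewrite riesz_capE => /(lb_ereal_inf_adherent e0)[_ [phi Ephi <-]].
by move=> /ltW; exists phi.
Qed.

Lemma le_riesz_cap E E' : E `<=` E' -> cap E <= cap E'.
Proof.
move=> EE'; rewrite !riesz_capE; apply: ereal_inf_le_tmp => _ [phi [mphi phi0 phi1] <-].
by exists phi => //; split => // x /EE'; exact: phi1.
Qed.

Lemma energyZ (a : R) phi : (0 <= a)%R -> measurable_fun setT phi ->
  (forall y, 0 <= phi y)%R ->
  energy (fun y => a * phi y)%R = (a `^ s)%:E * energy phi.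
Proof.
move=> a0 mphi phi0; rewrite /energy -ge0_integralZl//.
- by apply: eq_integral => y _; rewrite powRM// EFinM.
- exact: measurable_powR_EFin.
- by move=> y _; rewrite lee_fin powR_ge0.
- by rewrite lee_fin powR_ge0.
Qed.

Lemma riesz_cap0 : cap set0 = 0.
Proof.
apply/eqP; rewrite eq_le riesz_cap_ge0 andbT.
apply: (@le_trans _ _ (energy (cst 0%R))); first by apply: riesz_cap_le_energy; split.
rewrite /energy (eq_integral (cst 0)) ?integral0// => y _.
by rewrite powR0 ?gt_eqF.
Qed.

(** A Chebyshev inequality: [phi] divided by [d] is admissible, and the energy is homogeneous of
    degree [s]. *)
Lemma riesz_cap_superlevel (d : R) E phi : (0 < d)%R -> measurable_fun setT phi ->
  (forall y, 0 <= phi y)%R -> (forall x, E x -> d%:E <= pot phi x) ->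
  cap E <= ((d^-1) `^ s)%:E * energy phi.
Proof.
move=> d0 mphi phi0 Ed; have d0' : (0 <= d^-1)%R by rewrite invr_ge0 ltW.
rewrite -energyZ//; apply: riesz_cap_le_energy; split.
- exact: measurable_funM.
- by move=> x; rewrite mulr_ge0.
- move=> x /Ed dx; rewrite riesz_potentialZ//.
  by rewrite lee_pdivlMl// mule1.
Qed.

(* The test function for the union is [(\sum_k phi_k ^ s) ^ (1 / s)], which
   dominates every [phi_k] where the series is finite, hence almost everywhere. *)
Lemma riesz_cap_bigcup_le (E : (set 'rV[R]_n)^nat) (phi : nat -> 'rV[R]_n -> R) :
  (forall k, admissible (E k) (phi k)) ->
  cap (\bigcup_k E k) <= \sum_(k <oo) energy (phi k).
Proof.
move=> Ephi.
have phi0 k y : (0 <= phi k y)%R by have [] := Ephi k.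
have mphi k : measurable_fun setT (phi k) by have [] := Ephi k.
pose G y := \sum_(k <oo) (phi k y `^ s)%:E.
have phis0 k y : 0 <= (phi k y `^ s)%:E by rewrite lee_fin powR_ge0.
have G0 y : 0 <= G y by exact: nneseries_ge0.
have mG : measurable_fun setT G.
  by apply: ge0_emeasurable_sum => // k _; exact: measurable_powR_EFin.
have IG : \int[lebesgue_rV n]_y G y = \sum_(k <oo) energy (phi k).
  by rewrite integral_nneseries// => k; exact: measurable_powR_EFin.
have [->|Goo] := eqVneq (\sum_(k <oo) energy (phi k)) +oo; first exact: leey.
have iG : (lebesgue_rV n).-integrable setT G.
  apply/integrableP; split => //; under eq_integral do rewrite gee0_abs//.
  by rewrite IG ltey.
have Gfin : {ae lebesgue_rV n, forall y, G y \is a fin_num}.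
  by apply: filterS (integrable_ae measurableT iG) => y; exact.
pose psi y := (fine (G y) `^ s^-1)%R.
have mpsi : measurable_fun setT psi.
  apply: (@measurableT_comp _ _ _ _ _ _ (fun r : R => r `^ s^-1)%R) => //.
  exact: measurableT_comp.
have psi0 y : (0 <= psi y)%R by exact: powR_ge0.
rewrite -IG; apply: (@le_trans _ _ (energy psi)).
  apply: riesz_cap_le_energy; split => // x [k _ Ekx].
  have [_ _ /(_ _ Ekx)/le_trans] := Ephi k; apply.
  apply: ae_le_riesz_potential => //; apply: filterS Gfin => y Gy.
  have -> : phi k y = ((phi k y `^ s) `^ s^-1)%R.
    by rewrite -powRrM mulfV ?gt_eqF// powRr1.
  apply: ge0_ler_powR; rewrite ?nnegrE ?invr_ge0 ?powR_ge0 ?fine_ge0 ?(ltW s_gt0)//.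
  rewrite -lee_fin fineK// /G (@nneseriesD1 _ _ k)//.
  by rewrite leeDl// nneseries_ge0.
apply: ge0_le_integral => //.
- by move=> y _; rewrite lee_fin powR_ge0.
- exact: measurable_powR_EFin.
- move=> y _; rewrite -powRrM mulVf ?gt_eqF// powRr1 ?fine_ge0//.
  by case: (G y) (G0 y) => // [r _|_]; rewrite ?lee_fin ?leey.
Qed.

(** Unless some capacity is infinite, take test functions optimal up to [e / 2 ^ k.+1] and combine
    them by [riesz_cap_bigcup_le]. *)
Lemma riesz_cap_sigma_subadditive (E : (set 'rV[R]_n)^nat) :
  cap (\bigcup_k E k) <= \sum_(k <oo) cap (E k).
Proof.
have [[k Ek]|Efin] := pselect (exists k, cap (E k) = +oo).
  rewrite (@eseries_pinfty _ _ xpredT k)// ?leey// => i _.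
  by rewrite gt_eqF// (lt_le_trans _ (riesz_cap_ge0 _)) ?ltNye.
have {}Efin k : cap (E k) < +oo by rewrite ltey; apply/eqP => Ek; apply: Efin; exists k.
apply/lee_addgt0Pr => e e0.
have ek k : (0 < e / (2 ^ k.+1)%:R)%R by rewrite divr_gt0// ltr0n expn_gt0.
have /choice[phi phiP] k : exists phi, admissible (E k) phi /\
    energy phi <= cap (E k) + (e / (2 ^ k.+1)%:R)%:E.
  by have [phi ? ?] := riesz_cap_approx (ek k) (Efin k); exists phi.
apply: le_trans (epsilon_trick xpredT (fun k => riesz_cap_ge0 (E k)) (ltW e0)).
apply: le_trans (riesz_cap_bigcup_le (fun k => (phiP k).1)) _.
by apply: lee_nneseries => [k *|k *]; [exact: energy_ge0|exact: (phiP k).2].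
Qed.

Lemma riesz_cap_sigma_subadditiveS (A : set 'rV[R]_n) (E : (set 'rV[R]_n)^nat) :
  A `<=` \bigcup_k E k -> cap A <= \sum_(k <oo) cap (E k).
Proof. by move=> /le_riesz_cap/le_trans; apply; exact: riesz_cap_sigma_subadditive. Qed.

Lemma riesz_capU (A B : set 'rV[R]_n) : cap (A `|` B) <= cap A + cap B.
Proof.
have := @riesz_cap_sigma_subadditive (fun k => if k is 0%N then A else if k is 1%N then B else set0).
rewrite (nneseries_split 0 2)/=; last by move=> k _; exact: riesz_cap_ge0.
rewrite big_nat_recl//= big_nat_recl//= big_geq// eseries0; last first.
  by move=> [|[|k]]//= _ _; exact: riesz_cap0.
rewrite !adde0; apply: le_trans; apply: le_riesz_cap => x [Ax|Bx].
  by exists 0%N.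
by exists 1%N.
Qed.

(** Every test function for [E] is pulled back as in [riesz_potential_affine]; its energy gains the
    exponent [alpha * s] from the factor and loses [n] to the Jacobian. *)
Lemma riesz_cap_affine (a : R) (b : 'rV[R]_n) E : (0 < a)%R ->
  cap ((fun y => a *: y + b)%R @^-1` E) <= ((a `^ (alpha * s - n%:R)))%:E * cap E.
Proof.
move=> a0; have as0 : (0 < a `^ (alpha * s - n%:R))%R by exact: powR_gt0.
rewrite muleC -lee_pdivrMr//.
rewrite [leRHS]riesz_capE; apply: le_ereal_inf_tmp => _ [phi [mphi phi0 phi1] <-].
rewrite lee_pdivrMr// muleC.
have mphi' : measurable_fun setT (fun y => phi (a *: y + b)%R).
  by apply: (measurableT_comp mphi); exact: measurable_affine_rV.
apply: (@le_trans _ _ (energy (fun y => a `^ alpha * phi (a *: y + b))%R)).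
  apply: riesz_cap_le_energy; split.
  - exact: measurable_funM.
  - by move=> y; rewrite mulr_ge0// powR_ge0.
  - by move=> x Ex; rewrite riesz_potential_affine//; exact: phi1.
rewrite energyZ ?powR_ge0// /energy.
rewrite [X in _ <= _ * X](ge0_integral_lebesgue_rV_affine b a0); last 2 first.
- by move=> x; rewrite lee_fin powR_ge0.
- exact: measurable_powR_EFin.
rewrite muleA -EFinM -powRrM -powR_mulrn ?(ltW a0)// -powRD ?subrK//.
by rewrite (gt_eqF a0) implybT.
Qed.

End riesz_capacity.

(** * Cubes and the growth of their capacity *)

Section cubes.
Context {R : realType} {n : nat}.
Implicit Types (x y : 'rV[R]_n) (r : R).

(** Sup-norm balls contain the Euclidean balls of the same radius and fit the dyadic grid. *)
Definition cube x r : set 'rV[R]_n :=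
  [set y | forall i, `|y ord0 i - x ord0 i| < r].

Lemma measurable_cube x r : measurable (cube x r).
Proof.
rewrite (_ : cube x r = \bigcap_(i in [set: 'I_n])
    ((fun v : 'rV[R]_n => v ord0 i) @^-1` `]x ord0 i - r, x ord0 i + r[%classic)).
  apply: fin_bigcap_measurable => // i _.
  by rewrite -[X in measurable X]setTI; apply: measurable_coord_rV => //; exact: measurable_itv.
by apply/seteqP; split=> [y xy i _|y xy i]; [move: (xy i)|move: (xy i I)];
  rewrite /= in_itv/= ltr_distl.
Qed.

Lemma eball_sub_cube x r : eball x r `<=` cube x r.
Proof.
move=> y xy i; apply: le_lt_trans xy.
by apply: le_trans (ler_coord_enorm _ i); rewrite !mxE.
Qed.

Variables alpha s : R.
Hypotheses (alpha_ltn : alpha < n%:R) (s_gt0 : 0 < s).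
Local Open Scope ereal_scope.
Local Notation cap := (@riesz_cap R n alpha s).

Lemma riesz_cap_cube_le x r : (0 < r)%R ->
  cap (cube x r) <=
  (((n.+1)%:R * r) `^ (n%:R - alpha * s))%:E * cap (eball 0%R 1%R).
Proof.
(* Dilation by [a] sends the cube into the open unit ball: the factor [n.+1] exceeds the constant
   [n] of [enorm_le_coord], so the inequality is strict. *)
move=> r0; pose a := ((n.+1)%:R * r)^-1%R.
have a0 : (0 < a)%R by rewrite invr_gt0 mulr_gt0.
rewrite -[(_ * r)%R]invrK -/a -powR_inv1 ?(ltW a0)// -powRrM mulN1r opprB.
apply: le_trans (riesz_cap_affine alpha_ltn s_gt0 (- (a *: x))%R _ a0).
apply: (le_riesz_cap alpha s_gt0) => y xy; rewrite /eball /= subr0 -scalerBr enormZ ?(ltW a0)//.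
apply: (@le_lt_trans _ _ (a * (n%:R * r))%R).
  rewrite ler_wpM2l ?(ltW a0)//; apply: enorm_le_coord; first exact: ltW.
  by move=> i; rewrite !mxE; exact/ltW/xy.
by rewrite /a mulrC ltr_pdivrMr ?mulr_gt0// mul1r ltr_pM2r// ltr_nat.
Qed.

(** Handles the degenerate normalization: countably many cubes exhaust the space, and by scaling
    each of them is null. *)
Lemma riesz_cap_eq0 : cap (eball 0%R 1%R) = 0 -> forall E, cap E = 0.
Proof.
move=> c0 E; apply/eqP; rewrite eq_le riesz_cap_ge0// andbT.
have : E `<=` \bigcup_k cube 0%R k.+1%:R.
  move=> v _; pose M := (\sum_(i < n) `|v ord0 i|)%R.
  exists (Num.truncn M) => // i /=; rewrite mxE subr0.
  apply: le_lt_trans (truncnS_gt M).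
  by rewrite /M (bigD1 i)//= lerDl sumr_ge0.
move=> /(riesz_cap_sigma_subadditiveS alpha_ltn s_gt0)/le_trans; apply.
rewrite eseries0// => k _ _; apply/eqP; rewrite eq_le riesz_cap_ge0// andbT.
by apply: le_trans (riesz_cap_cube_le _ _) _ => //; rewrite c0 mule0.
Qed.

End cubes.

(** * Covering by maximal dyadic cubes *)

Section dyadic_cubes.
Context {R : realType} {n : nat}.
Variable L : R.
Hypothesis L_gt0 : 0 < L.
Implicit Types (x y : 'rV[R]_n) (j : nat).

Definition dyadic_side j : R := L / 2 ^+ j.

Definition dyadic_index j x : {ffun 'I_n -> int} :=
  [ffun i => Num.floor (x ord0 i / dyadic_side j)].

Definition dyadic j (z : {ffun 'I_n -> int}) : set 'rV[R]_n :=
  [set x | dyadic_index j x = z].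

Local Notation side := dyadic_side.
Local Notation index := dyadic_index.

Lemma dyadic_side_gt0 j : 0 < side j.
Proof. by rewrite divr_gt0// exprn_gt0. Qed.

Lemma dyadic_sideS j : side j = 2 * side j.+1.
Proof. by rewrite /side exprS; field; rewrite expf_neq0. Qed.

Lemma dyadic_side_le j k : (j <= k)%N -> side k <= side j.
Proof.
move=> jk; rewrite ler_pM2l// lef_pV2 ?posrE ?exprn_gt0//.
by apply: ler_weXn2l => //; rewrite ler1n.
Qed.

Lemma dyadic_side_small (r : R) : 0 < r -> exists j, side j < r.
Proof.
move=> r0; exists (Num.truncn (L / r)).+1.
rewrite ltr_pdivrMr ?exprn_gt0// mulrC -ltr_pdivrMr//.
apply: (lt_trans (truncnS_gt _)); rewrite -natrX ltr_nat.
exact: ltn_expl.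
Qed.

(** An integer [m] satisfies [m <= a] exactly when [2 * m <= Num.floor (2 * a)], so the floor of
    [2 * a] determines that of [a]. *)
Let floor_double (a b : R) : Num.floor (2 * a) = Num.floor (2 * b) ->
  Num.floor a <= Num.floor b.
Proof.
move=> ab; rewrite floor_ge_int -(ler_pM2l (ltr0n R 2)).
have -> : 2%:R * (Num.floor a)%:~R = (2 * Num.floor a)%:~R :> R by rewrite intrM.
by rewrite -floor_ge_int -ab floor_ge_int intrM ler_pM2l// floor_le.
Qed.

(** Passing to the parent cube halves the quotients whose floors form the index; [floor_double]
    handles one generation. *)
Lemma dyadic_nested j k x y : (j <= k)%N -> index k x = index k y ->
  index j x = index j y.
Proof.
move=> /subnKC <-; elim: (k - j)%N => [|m IHm]; first by rewrite addn0.
rewrite addnS => xy; apply: IHm; apply/ffunP => i; rewrite !ffunE.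
have {xy} /ffunP/(_ i) := xy; rewrite !ffunE => xy.
have E (v : 'rV[R]_n) : v ord0 i / side (j + m).+1 = 2 * (v ord0 i / side (j + m)).
  rewrite [in RHS]dyadic_sideS; field.
  by rewrite gt_eqF// dyadic_side_gt0.
by rewrite !E in xy; apply/eqP; rewrite eq_le !floor_double.
Qed.

Lemma measurable_dyadic j z : measurable (dyadic j z).
Proof.
rewrite (_ : dyadic j z = \bigcap_(i in [set: 'I_n])
  ((fun v : 'rV[R]_n => v ord0 i) @^-1`
    `[(z i)%:~R * side j, (z i + 1)%:~R * side j[%classic)).
  apply: fin_bigcap_measurable => // i _.
  by rewrite -[X in measurable X]setTI; apply: measurable_coord_rV => //; exact: measurable_itv.
have E (v : 'rV[R]_n) i : (v ord0 i \in `[(z i)%:~R * side j, (z i + 1)%:~R * side j[) =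
    (Num.floor (v ord0 i / side j) == z i).
  by rewrite in_itv/= floor_eq ler_pdivlMr ?ltr_pdivrMr ?dyadic_side_gt0.
apply/seteqP; split=> [v /ffunP vz i _|v vz] /=.
  by rewrite E; move: (vz i); rewrite ffunE => ->.
by apply/ffunP => i; rewrite ffunE; apply/eqP; rewrite -E; exact: (vz i).
Qed.

Lemma dyadic_sub_cube j x y : index j x = index j y -> cube x (side j) y.
Proof.
move=> /ffunP xy i; move: (xy i); rewrite !ffunE => E.
have s0 := dyadic_side_gt0 j.
have /andP[] := floor_itv (x ord0 i / side j).
have /andP[] := floor_itv (y ord0 i / side j).
rewrite -E !intrD !ler_pdivlMr// !ltr_pdivrMr// ltr_distl => h1 h2 h3 h4.
by apply/andP; split; lra.
Qed.

(* The neighbours of a dyadic cube, itself included, are indexed by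
   [{0,1,2}^n], the digit [1] standing for a zero shift. *)
Definition dyadic_shift (z : {ffun 'I_n -> int}) (e : {ffun 'I_n -> 'I_3}) :
  {ffun 'I_n -> int} := [ffun i => z i + (e i)%:Z - 1].

(** Numbers at distance less than one have floors that differ by at most one. *)
Lemma cube_sub_dyadic_shift j x r : r <= side j ->
  cube x r `<=` \bigcup_e dyadic j (dyadic_shift (index j x) e).
Proof.
move=> rj y xy; have s0 := dyadic_side_gt0 j.
have h i : exists e : 'I_3, Num.floor (y ord0 i / side j) =
    Num.floor (x ord0 i / side j) + (e : nat)%:Z - 1.
  have : `|y ord0 i / side j - x ord0 i / side j| < 1.
    by rewrite -mulrBl normrM normfV (gtr0_norm s0) ltr_pdivrMr// mul1r (lt_le_trans (xy i)).
  have /andP[] := floor_itv (x ord0 i / side j).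
  have /andP[] := floor_itv (y ord0 i / side j).
  set a := Num.floor (y ord0 i / side j); set b := Num.floor (x ord0 i / side j).
  rewrite !intrD ltr_distl => h1 h2 h3 h4 /andP[h5 h6].
  have ab : a < b + 2 by rewrite -(ltr_int R) intrD; lra.
  have ba : b < a + 2 by rewrite -(ltr_int R) intrD; lra.
  have [k ak] : exists k : nat, a = b + k%:Z - 1.
    exists `|(a - b + 1)%R|%N; rewrite gez0_abs; lia.
  have k3 : (k < 3)%N by lia.
  by exists (Ordinal k3).
have [e he] := choice h.
exists (finfun e) => //; apply/ffunP => i.
by rewrite !ffunE he.
Qed.

Lemma dyadic_shift_sub_cube j x y e : dyadic j (dyadic_shift (index j x) e) y ->
  cube y (2 * side j) x.
Proof.
move=> /ffunP xy i; move: (xy i); rewrite !ffunE; have s0 := dyadic_side_gt0 j.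
have /andP[] := floor_itv (x ord0 i / side j).
have /andP[] := floor_itv (y ord0 i / side j).
set a := Num.floor (y ord0 i / side j); set b := Num.floor (x ord0 i / side j).
rewrite !intrD !ler_pdivlMr// !ltr_pdivrMr// => h1 h2 h3 h4 abe.
have e3 := ltn_ord (e i).
have ab : a%:~R <= b%:~R + 1 :> R by rewrite -(intrD _ _ 1) ler_int; lia.
have ba : b%:~R <= a%:~R + 1 :> R by rewrite -(intrD _ _ 1) ler_int; lia.
rewrite ltr_distl; apply/andP; split; nra.
Qed.

End dyadic_cubes.

(** * A fractional maximal function of a measure *)

Section covering.
Context {R : realType} {n : nat}.
Local Notation V := 'rV[R]_n.
Local Open Scope ereal_scope.

(** Pigeonhole: the cube is covered by [3 ^ n] neighbouring dyadic cubes. *)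
Lemma exists_dyadic_gt (nu : {measure set V -> \bar R}) (L : R) (j : nat)
    (x : V) (r a : R) : (0 < L)%R -> (r <= dyadic_side L j)%R ->
  a%:E < nu (cube x r) ->
  exists e, (a / (3 ^ n)%:R)%:E <
    nu (dyadic L j (dyadic_shift (dyadic_index L j x) e)).
Proof.
move=> L0 rj anu; apply: contrapT => /forallNP h.
pose T := {ffun 'I_n -> 'I_3}.
move: anu; apply/negP; rewrite -leNgt.
pose Q (e : T) := dyadic L j (dyadic_shift (dyadic_index L j x) e).
have := @content_sub_fsum _ _ _ nu _ [set` enum T] (cube x r) Q.
move=> /(_ _ _ _ _)/le_trans; apply.
- exact: finite_seq.
- by move=> e _; exact: measurable_dyadic.
- exact: measurable_cube.
- apply: (subset_trans (cube_sub_dyadic_shift L0 rj)) => y [e _ ye].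
  by exists e => //=; rewrite mem_enum.
rewrite -fsbig_seq ?enum_uniq// big_enum/=.
apply: (@le_trans _ _ (\sum_(e : T) (a / (3 ^ n)%:R)%:E)).
  by apply: lee_sum => e _; rewrite leNgt; exact/negP/h.
rewrite sumEFin sumr_const card_ffun !card_ord lee_fin -[leLHS]mulr_natr.
by rewrite divfK// pnatr_eq0 expn_eq0.
Qed.

(** [c] abstracts the capacity: a monotone, countably subadditive set function growing on cubes at
    most like the power [d] of the radius. *)
Variables (c : set V -> \bar R) (K d : R).
Hypotheses (c_ge0 : forall E, 0 <= c E) (c_set0 : c set0 = 0)
  (le_c : forall E E', E `<=` E' -> c E <= c E')
  (c_bigcup : forall E (F : (set V)^nat), E `<=` \bigcup_k F k ->
    c E <= \sum_(k <oo) c (F k))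
  (c_cube : forall x (r : R), (0 < r)%R -> c (cube x r) <= (K * r `^ d)%:E)
  (K_gt0 : (0 < K)%R) (d_gt0 : (0 < d)%R).

(* Every point of the set lies near a dyadic cube of large [nu]-measure. The
   maximal such cubes are disjoint, so their measures add up. *)
Lemma fractional_maximal_weak_type (nu : {measure set V -> \bar R}) (t : R) :
  (0 < t)%R ->
  c [set x | exists2 r : R, (0 < r)%R & (t * r `^ d)%:E < nu (cube x (2 * r)%R)] <=
  (K * 16 `^ d * (3 ^ n)%:R / t)%:E * nu setT.
Proof.
move=> t0; set G := [set x | _].
have p3 : (0 < (3 ^ n)%:R :> R)%R by rewrite ltr0n expn_gt0.
have C0 : (0 < K * 16 `^ d * (3 ^ n)%:R / t)%R.
  by rewrite divr_gt0// !mulr_gt0// powR_gt0.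
have [->|nufin] := eqVneq (nu setT) +oo; first by rewrite gt0_muley ?leey ?lte_fin.
have {nufin} nufin : nu setT \is a fin_num by rewrite ge0_fin_numE// ltey.
pose N := fine (nu setT).
have N0 : (0 <= N)%R by rewrite fine_ge0.
(* A radius [r] occurring in [G] is less than [rho], because the mass of a cube is at most [N].
   Hence [2 * r] is below the top side [L]. *)
pose rho := ((N / t) `^ d^-1)%R.
pose L : R := (2 * rho + 1)%R.
have rho0 : (0 <= rho)%R by exact: powR_ge0.
have L0 : (0 < L)%R by rewrite /L; lra.
pose side := dyadic_side L.
have side0 j : (0 < side j)%R by exact: dyadic_side_gt0.
pose Q j (x : V) := dyadic L j (dyadic_index L j x).
(* The threshold for dyadic cubes: [3 ^ n] is lost in the pigeonhole, and the power of [4] because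
   the chosen side is at most [4 * r]. *)
pose t1 := (t / (3 ^ n)%:R / 4 `^ d)%R.
have t10 : (0 < t1)%R by rewrite !divr_gt0// powR_gt0.
pose good j y := (t1 * side j `^ d)%:E < nu (Q j y).
(* Smaller generations are larger cubes, so a maximal cube is a good one without good ancestor. *)
pose maximal j z := exists y : V, [/\ dyadic_index L j y = z, good j y &
  forall k, (k < j)%N -> ~ good k y].
(* [A] enumerates the maximal cubes through the codes of pairs of generation and index, with the
   empty set at all other codes. [F] enumerates their neighbourhoods, which will cover [G]. *)
pose A i : set V := if pickle_inv i is Some (j, z) then
  if `[<maximal j z>] then dyadic L j z else set0 else set0.
pose F i : set V := if pickle_inv i is Some (j, z) then
  if `[<maximal j z>] then
    [set x | exists2 y, dyadic L j z y & cube y (2 * side j)%R x]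
  else set0 else set0.
have Qeq j x y : dyadic_index L j x = dyadic_index L j y -> Q j x = Q j y.
  by rewrite /Q => ->.
have mA i : measurable (A i).
  rewrite /A; case Ei : (pickle_inv i) => [[j z]|//]; case: asboolP => // _.
  exact: measurable_dyadic.
have tA : trivIset setT A.
  apply/trivIsetP => i k _ _ ik; apply/seteqP; split => // w []; move: ik.
  rewrite /A; case Ei : (pickle_inv i) => [[j z]|//].
  case Ek : (pickle_inv k) => [[j' z']|//].
  case: asboolP => // -[y [yz gy my]]; case: asboolP => // -[y' [yz' gy' my']].
  rewrite /dyadic /= => ik wz wz'; suff : (j, z) = (j', z').
    move=> E; move/eqP: ik; apply.
    have /= := @pickle_invK (nat * {ffun 'I_n -> int})%type i; rewrite Ei /= => <-.
    by have /= := @pickle_invK (nat * {ffun 'I_n -> int})%type k; rewrite Ek /= => <-; rewrite E.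
  (* A common point [w] inherits goodness and minimality from both witnesses, which forces equal
     generations and then equal indices. *)
  have gw : good j w by rewrite /good (Qeq _ _ y)// wz.
  have gw' : good j' w by rewrite /good (Qeq _ _ y')// wz'.
  have mw k' : (k' < j)%N -> ~ good k' w.
    move=> kj; rewrite /good (Qeq _ _ y); first exact: my.
    by apply: (dyadic_nested L0 (ltnW kj)); rewrite wz.
  have mw' k' : (k' < j')%N -> ~ good k' w.
    move=> kj; rewrite /good (Qeq _ _ y'); first exact: my'.
    by apply: (dyadic_nested L0 (ltnW kj)); rewrite wz'.
  have jj' : j = j'.
    by case: (ltngtP j j') => // [/mw'|/mw].
  by rewrite -wz -wz' jj'.
have cF i : c (F i) <= (K * 4 `^ d / t1)%:E * nu (A i).
  rewrite /F /A; case Ei : (pickle_inv i) => [[j z]|]; last first.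
    by rewrite c_set0 measure0 mule0.
  case: asboolP => [[y [yz gy _]]|_]; last by rewrite c_set0 measure0 mule0.
  (* A point of [F i] is within two sides of some [y'] in the cube, and [y'] is within one side of
     [y]. This second power of [4], with the one in [t1], makes the [16] of the constant. *)
  apply: (@le_trans _ _ (c (cube y (4 * side j)%R))).
    apply: le_c => x [y' yz' xy'] l.
    have : cube y (side j) y' by apply: dyadic_sub_cube => //; rewrite yz.
    move=> /(_ l); move: (xy' l); have := side0 j.
    by rewrite !ltr_distl => s0 /andP[? ?] /andP[? ?]; apply/andP; split; lra.
  apply: (le_trans (c_cube _ _)); first by rewrite mulr_gt0.
  have -> : (K * (4 * side j) `^ d = K * 4 `^ d / t1 * (t1 * side j `^ d))%R.
    by rewrite powRM// ?(ltW (side0 j))//; field; rewrite gt_eqF.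
  rewrite EFinM; apply: lee_wpmul2l.
    by rewrite lee_fin divr_ge0 ?(ltW t10)// mulr_ge0 ?powR_ge0// ltW.
  by move: gy; rewrite /good /Q yz => /ltW.
have GF : G `<=` \bigcup_i F i.
  move=> x [r r0 xr].
  have rrho : (r < rho)%R.
    have : (t * r `^ d)%:E < N%:E.
      rewrite /N fineK//; apply: (lt_le_trans xr).
      by apply: le_measure => //; rewrite inE//; exact: measurable_cube.
    rewrite lte_fin mulrC -ltr_pdivlMr// => rN.
    have -> : r = ((r `^ d) `^ d^-1)%R.
      by rewrite -powRrM mulfV ?gt_eqF// powRr1// ltW.
    by apply: gt0_ltr_powR; rewrite ?nnegrE ?invr_gt0 ?powR_ge0// divr_ge0 // ltW.
  have [j0 j0r] := dyadic_side_small L (mulr_gt0 (ltr0n R 2) r0).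
  (* The finest generation with side at least [2 * r]. At generation [0], where minimality says
     nothing, the choice of [L] gives the bound. *)
  have [j jr jmin] : exists2 j, (side j.+1 < 2 * r)%R & (2 * r <= side j)%R.
    have ex : exists j, (side j.+1 < 2 * r)%R.
      by exists j0; apply: le_lt_trans j0r; exact: dyadic_side_le.
    case: (ex_minnP ex) => j jr jmin; exists j => //.
    case: j jr jmin => [|j] jr jmin; last first.
      by rewrite leNgt; apply/negP => /jmin; rewrite ltnn.
    by rewrite /side /dyadic_side expr0 divr1 /L; lra.
  have [e he] := exists_dyadic_gt L0 jmin xr.
  have /set0P[y ye] : dyadic L j (dyadic_shift (dyadic_index L j x) e) != set0.
    apply/eqP => E; move: he; rewrite E measure0 lte_fin.
    by rewrite ltNge divr_ge0// mulr_ge0 ?powR_ge0// ltW.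
  have gjy : good j y.
    apply: le_lt_trans (_ : _ < nu (Q j y)); last first.
      by rewrite /Q ye; exact: he.
    have -> : (t * r `^ d / (3 ^ n)%:R = t1 * (4 * r) `^ d)%R.
      rewrite powRM ?(ltW r0)// /t1; field.
      by rewrite !gt_eqF// powR_gt0.
    rewrite lee_fin ler_pM2l//; apply: ge0_ler_powR; rewrite ?nnegrE ?(ltW d_gt0)//.
    - exact: ltW.
    - by rewrite mulr_ge0// ltW.
    - by rewrite /side dyadic_sideS -/side; lra.
  (* The good cube is replaced by its largest good ancestor; sides only grow, so [x] stays in the
     neighbourhood. *)
  have exk : exists k, good k y by exists j.
  case: (ex_minnP exk) => k gk kmin.
  have kj : (k <= j)%N by exact: kmin.
  exists (pickle (k, dyadic_index L k y)) => //.
  rewrite /F pickleK_inv; case: asboolP => [_|]; last first.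
    case; exists y; split => // k' k'k /kmin.
    by rewrite leqNgt k'k.
  exists y => // i; apply: (lt_le_trans (dyadic_shift_sub_cube L0 ye i)).
  by rewrite ler_pM2l// dyadic_side_le.
apply: (le_trans (c_bigcup GF)).
apply: (@le_trans _ _ (\sum_(i <oo) (K * 4 `^ d / t1)%:E * nu (A i))).
  by apply: lee_nneseries => [i *|i *]; [exact: c_ge0|exact: cF].
rewrite nneseriesZl; last by move=> i _; exact: measure_ge0.
have -> : (K * 4 `^ d / t1 = K * 16 `^ d * (3 ^ n)%:R / t)%R.
  rewrite /t1 (_ : 16 = 4 * 4)%R; last by lra.
  rewrite powRM//; field.
  by rewrite !gt_eqF// powR_gt0.
apply: lee_wpmul2l; first by rewrite lee_fin ltW.
rewrite -measure_semi_bigcup//; last exact: bigcup_measurable.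
by apply: le_measure => //; rewrite inE//; exact: bigcup_measurable.
Qed.

End covering.

(** * Dyadic sums and integrals of monotone functions *)

Section layer_cake.
Context {R : realType}.
Variable h : R -> \bar R.
Hypotheses (h_ge0 : forall t, (0 <= h t)%E)
  (h_noninc : forall t u, t <= u -> (h u <= h t)%E).
Local Open Scope ereal_scope.
Local Notation mu := (@lebesgue_measure R).

(** The superlevel sets of a monotone function are intervals. *)
Lemma measurable_nonincreasing (D : set R) : measurable D -> measurable_fun D h.
Proof.
move=> mD; apply: (measurability _ (ErealGenOInfty.measurableE R)) => _ [_ [r ->] <-].
apply: measurableI => //; apply: is_interval_measurable => t u /=.
rewrite !in_itv/= !andbT => rt ru v /andP[_ vu].
by rewrite in_itv/= andbT (lt_le_trans ru)// h_noninc.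
Qed.

Variable sigma : R.
Hypothesis sigma_gt0 : (0 < sigma)%R.

(** These intervals partition the half-line beyond [sigma], and each is as long as its left end
    point. *)
Let I k : set R := `](2 ^+ k * sigma)%R, (2 ^+ k.+1 * sigma)%R]%classic.

Let mI k : measurable (I k).
Proof. exact: measurable_itv. Qed.

Let pow_le k l : (k <= l)%N -> (2 ^+ k * sigma <= 2 ^+ l * sigma)%R.
Proof. by move=> kl; rewrite ler_pM2r// ler_weXn2l// ler1n. Qed.

Let muI k : mu (I k) = (2 ^+ k * sigma)%:E.
Proof.
rewrite /I lebesgue_measure_itv/= lte_fin exprS ltr_pM2r// ltr_pMl ?exprn_gt0//.
rewrite ltr1n/= -EFinB; congr EFin; ring.
Qed.

Let trivIset_I : trivIset setT I.
Proof.
apply: ltn_trivIset => k l kl; apply/seteqP; split => // t [].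
rewrite /I/= !in_itv/= => /andP[_ tl] /andP[lt _]; move: (lt_le_trans lt tl).
by rewrite ltNge pow_le.
Qed.

Let bigcup_I : \bigcup_k I k = `]sigma, +oo[%classic.
Proof.
apply/seteqP; split => [t [k _]|t] /=; rewrite !in_itv/= ?andbT.
  move=> /andP[kt _]; apply: le_lt_trans kt.
  by have := @pow_le 0 k isT; rewrite expr0 mul1r.
move=> st; have ex : exists k, (t <= 2 ^+ k.+1 * sigma)%R.
  exists (Num.truncn (t / sigma)); rewrite -ler_pdivrMr//.
  apply/ltW/(lt_trans (truncnS_gt _)); rewrite -natrX ltr_nat; exact: ltn_expl.
case: (ex_minnP ex) => k tk kmin; exists k => //; rewrite /I/= in_itv/= tk andbT.
case: k tk kmin => [|k] tk kmin; first by rewrite expr0 mul1r.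
by rewrite ltNge; apply/negP => /kmin; rewrite ltnn.
Qed.

Let integral_I : \int[mu]_(t in `]sigma, +oo[) h t =
  \sum_(k <oo) \int[mu]_(t in I k) h t.
Proof.
have mU : measurable (\bigcup_k I k).
  exact: bigcup_measurable.
rewrite -bigcup_I ge0_integral_bigcup//.
exact: measurable_nonincreasing mU.
Qed.

(** [M] bounds [h] up to [sigma]; beyond, [h] is bounded on each [I k] by its value at the left end
    point. *)
Lemma integral_le_dyadic_sum (M : \bar R) : 0 <= M -> (forall t, h t <= M) ->
  \int[mu]_(t in `]0%R, +oo[) h t <=
  sigma%:E * M + \sum_(k <oo) (2 ^+ k * sigma)%:E * h (2 ^+ k * sigma)%R.
Proof.
move=> M0 hM.
have -> : `]0%R, +oo[%classic = `]0%R, sigma] `|` `]sigma, +oo[ :> set R.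
  by apply: itv_bndbnd_setU; rewrite ?bnd_simp// ltW.
rewrite ge0_integral_setU//=; last 2 first.
- exact: measurable_nonincreasing (measurableU _ _ _ _).
- apply/disj_setPRL => t /=; rewrite !in_itv/= andbT => st.
  by apply/negP; rewrite negb_and -!ltNge st orbT.
apply: leeD.
  apply: (@le_trans _ _ (\int[mu]_(t in `]0%R, sigma]) cst M t)).
    apply: ge0_le_integral => //; first exact: measurable_nonincreasing.
  rewrite integral_cst//= lebesgue_measure_itv/= lte_fin sigma_gt0 oppr0 addr0 muleC.
  by [].
rewrite integral_I; apply: lee_nneseries => [k _ _|k _]; first exact: integral_ge0.
apply: (@le_trans _ _ (\int[mu]_(t in I k) cst (h (2 ^+ k * sigma)%R) t)).
  apply: ge0_le_integral => //; [exact: mI|exact: measurable_nonincreasing|].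
  by move=> t; rewrite /I/= in_itv/= => /andP[kt _]; apply: h_noninc; exact: ltW.
by rewrite integral_cst//= ?muI 1?muleC//; exact: mI.
Qed.

(** On [I k] the value at the right end point is a lower bound. *)
Lemma dyadic_sumS_le_integral :
  \sum_(k <oo) (2 ^+ k * sigma)%:E * h (2 ^+ k.+1 * sigma)%R <=
  \int[mu]_(t in `]0%R, +oo[) h t.
Proof.
apply: (@le_trans _ _ (\int[mu]_(t in `]sigma, +oo[) h t)); last first.
  apply: ge0_subset_integral => //; first exact: measurable_nonincreasing.
  by move=> t /=; rewrite !in_itv/= !andbT; exact: lt_trans.
rewrite integral_I; apply: lee_nneseries => [k _ _|k _].
  by rewrite mule_ge0// lee_fin mulr_ge0 ?exprn_ge0// ltW.
apply: (@le_trans _ _ (\int[mu]_(t in I k) cst (h (2 ^+ k.+1 * sigma)%R) t)).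
  by rewrite integral_cst//= ?muI 1?muleC//; exact: mI.
apply: ge0_le_integral => //; [exact: mI|by move=> ? _; exact: h_ge0|
  exact: measurable_nonincreasing|].
by move=> t; rewrite /I/= in_itv/= => /andP[_ tk]; exact: h_noninc.
Qed.

End layer_cake.

Lemma dyadic_sum_le_integral {R : realType} (h : R -> \bar R) (sigma : R) :
  (forall t, (0 <= h t)%E) -> (forall t u, t <= u -> (h u <= h t)%E) ->
  0 < sigma ->
  (\sum_(k <oo) (2 ^+ k * sigma)%:E * h (2 ^+ k * sigma)%R <=
  2%:E * \int[lebesgue_measure]_(t in `]0%R, +oo[) h t)%E.
Proof.
(* Starting the partition at [sigma / 2] moves the right end points to the required nodes and halves
   the lengths, whence the factor [2]. *)
move=> h0 hn s0; have s2 : 0 < sigma / 2 by rewrite divr_gt0.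
have := dyadic_sumS_le_integral h0 hn s2.
rewrite -(lee_pmul2l (x := 2%:E))// -nneseriesZl; last first.
  by move=> k _; rewrite mule_ge0// lee_fin mulr_ge0 ?exprn_ge0// ltW.
apply: le_trans; apply: lee_nneseries => [k _ _|k _].
  by rewrite mule_ge0// lee_fin mulr_ge0 ?exprn_ge0// ltW.
rewrite muleA -EFinM.
have -> : 2 ^+ k.+1 * (sigma / 2) = 2 ^+ k * sigma by rewrite exprS; field.
by have -> : 2 * (2 ^+ k * (sigma / 2)) = 2 ^+ k * sigma by field.
Qed.

(** * The weak type inequality *)

Section density_measure.
Context d (T : measurableType d) (R : realType).
Variables (mu : {measure set T -> \bar R}) (g : T -> \bar R).
Hypotheses (mg : measurable_fun setT g) (g0 : forall x, (0 <= g x)%E).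
Local Open Scope ereal_scope.

(** The proofs are arguments so that the measure structure can be attached to the term. *)
Definition density of measurable_fun setT g & (forall x, (0 <= g x)%E) :=
  fun A => \int[mu]_(x in A) g x.

Local Notation nu := (density mg g0).

Let nu0 : nu set0 = 0.
Proof. exact: integral_set0. Qed.

Let nu_ge0 A : 0 <= nu A.
Proof. exact: integral_ge0. Qed.

Let nu_sigma_additive : semi_sigma_additive nu.
Proof.
move=> F mF tF mUF; rewrite /density ge0_integral_bigcup//.
  by apply: is_cvg_nneseries => k _ _; exact: integral_ge0.
exact: measurable_funTS.
Qed.

HB.instance Definition _ := isMeasure.Build _ _ _ nu nu0 nu_ge0 nu_sigma_additive.

End density_measure.

(** * Localising test functions to a ball *)

Section localisation.
Context {R : realType} {n : nat}.
Variables alpha s : R.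
Hypotheses (alpha_ltn : alpha < n%:R) (s_gt0 : 0 < s).
Implicit Types (x y z : 'rV[R]_n) (r : R) (phi : 'rV[R]_n -> R).
Local Open Scope ereal_scope.
Local Notation cap := (@riesz_cap R n alpha s).
Local Notation pot := (@riesz_potential R n alpha).

(** Some coordinate of [z] is at least [2 * r] away from that of [x], so [r <= enorm (y - z)]. Each
    coordinate of [x - z] is then at most twice that norm. *)
Lemma enorm_le_far x y z r : eball x r y -> ~ cube x (2 * r) z ->
  (enorm (x - z) <= (2 * n.+1%:R) * enorm (y - z))%R.
Proof.
move=> xy /existsNP[j /negP]; rewrite -leNgt => xz.
have xyi i : (`|y ord0 i - x ord0 i| < r)%R by exact: (eball_sub_cube xy).
have yzi i : (`|y ord0 i - z ord0 i| <= enorm (y - z))%R.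
  by apply: le_trans (ler_coord_enorm (y - z)%R i); rewrite !mxE.
have rzy : (r <= enorm (y - z))%R.
  apply: le_trans (yzi j); have := xyi j.
  have := ler_distD (y ord0 j) (z ord0 j) (x ord0 j).
  by rewrite (distrC (z ord0 j) (y ord0 j)); lra.
apply: (@le_trans _ _ (n%:R * (2 * enorm (y - z)))%R).
  apply: enorm_le_coord; first by rewrite mulr_ge0 ?enorm_ge0.
  move=> i; rewrite !mxE; have := xyi i; have := yzi i.
  have := ler_distD (y ord0 i) (x ord0 i) (z ord0 i).
  by rewrite (distrC (x ord0 i) (y ord0 i)); lra.
rewrite mulrA [(n%:R * 2)%R]mulrC ler_wpM2r ?enorm_ge0// ler_wpM2l//.
by rewrite ler_nat.
Qed.

(** The power is the loss in [riesz_kernel_le] with the ratio of [enorm_le_far]. The factor one half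
    keeps the far potential below [2^-1] on the ball. *)
Definition far_constant : R := ((2 * n.+1%:R) `^ (alpha - n%:R) / 2)%R.

Lemma far_constant_gt0 : (0 < far_constant)%R.
Proof. by rewrite divr_gt0// powR_gt0// mulr_gt0. Qed.

(* Split [phi] at the cube of radius [2 r]. The potential of the far part is
   comparable at all points of the ball, so if it is small at the centre the
   near part alone is admissible up to a factor [2]. *)
Lemma riesz_cap_localisation (E : set 'rV[R]_n) phi x r :
  admissible alpha E phi -> pot phi x < far_constant%:E ->
  cap (E `&` eball x r) <=
  (2 `^ s)%:E * \int[lebesgue_rV n]_(y in cube x (2 * r)) (phi y `^ s)%:E.
Proof.
move=> [mphi phi0 phi1] phix; pose Q := cube x (2 * r).
have mQ : measurable Q by exact: measurable_cube.
pose near y := (phi y * \1_Q y)%R; pose far y := (phi y * \1_(~` Q) y)%R.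
have mnear : measurable_fun setT near.
  by apply: measurable_funM => //; exact: measurable_indic.
have mfar : measurable_fun setT far.
  by apply: measurable_funM => //; apply: measurable_indic; exact: measurableC.
have near0 y : (0 <= near y)%R by rewrite mulr_ge0.
have far0 y : (0 <= far y)%R by rewrite mulr_ge0.
have phiE : phi = (fun y => near y + far y)%R.
  apply/funext => y; rewrite /near /far -mulrDr !indicE in_setC.
  by case: (y \in Q); rewrite ?addr0 ?add0r mulr1.
have far_lt y : eball x r y -> pot far y < 2^-1%:E.
  move=> xy; have a0 : (0 < (2 * n.+1%:R) `^ (alpha - n%:R) :> R)%R.
    by rewrite powR_gt0// mulr_gt0.
  rewrite -(lte_pmul2l (z := ((2 * n.+1%:R) `^ (alpha - n%:R))%:E))//.
  apply: le_lt_trans phix; rewrite -riesz_potentialZ ?(ltW a0)//.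
  apply: ge0_le_integral => //.
  - by move=> z _; rewrite mule_ge0 ?riesz_kernel_ge0// lee_fin mulr_ge0// ltW.
  - by apply: measurable_riesz_integrand => //; exact: measurable_funM.
  - exact: measurable_riesz_integrand.
  - move=> z _; rewrite /far indicE in_setC EFinM muleCA muleA.
    have [zQ|/negP zQ] := boolP (z \in Q).
      by rewrite mulr0 mule0 mule_ge0 ?riesz_kernel_ge0 ?lee_fin.
    rewrite mulr1; apply: lee_wpmul2r; first by rewrite lee_fin.
    apply: riesz_kernel_le => //.
    by apply: (enorm_le_far xy) => zQ'; apply: zQ; exact: mem_set.
have -> : \int[lebesgue_rV n]_(y in Q) (phi y `^ s)%:E = energy s near.
  rewrite integral_mkcond; apply: eq_integral => y _.
  rewrite /patch /near indicE; case: (y \in Q); first by rewrite mulr1.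
  by rewrite mulr0 powR0// gt_eqF.
(* The total potential is at least [1] and the far part below one half, so the near part exceeds one
   half. *)
rewrite -[2%R]invrK; apply: riesz_cap_superlevel => // y [Ey xy].
have := phi1 _ Ey; have := far_lt _ xy; rewrite phiE riesz_potentialD//.
move: (riesz_potential_ge0 alpha y near0) (riesz_potential_ge0 alpha y far0).
case: (pot near y) (pot far y) => [u| |] [v| |]//; rewrite ?leey//.
by rewrite -EFinD !lee_fin !lte_fin => *; lra.
Qed.

End localisation.

(** * The weak type bound for a decreasing family of sets *)

Section weak_type.
Context {R : realType} {n : nat}.
Variables alpha s b : R.
Hypotheses (alpha_ltn : alpha < n%:R) (s_gt0 : 0 < s).
Implicit Types (x y z : 'rV[R]_n) (r : R) (phi : 'rV[R]_n -> R).
Local Open Scope ereal_scope.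
Local Notation cap := (@riesz_cap R n alpha s).
Local Notation pot := (@riesz_potential R n alpha).
Local Notation d := (n%:R - alpha * s)%R.
Local Notation fc := (@far_constant R n alpha).
Hypotheses (d_gt0 : (0 < d)%R) (b_gt0 : (0 < b)%R)
  (capB : cap (eball 0%R 1%R) = b%:E).

Let K : R := (n.+1%:R `^ d * b)%R.

Let K_gt0 : (0 < K)%R.
Proof. by rewrite mulr_gt0// powR_gt0. Qed.

Let cap_cube x r : (0 < r)%R -> cap (cube x r) <= (K * r `^ d)%:E.
Proof.
move=> r0; apply: (le_trans (riesz_cap_cube_le alpha_ltn s_gt0 x r0)).
by rewrite capB -EFinM powRM ?(ltW r0)// /K mulrAC.
Qed.

(* Below the level [level_ratio * t], the choquet integral over a ball of radius
   [r] is at most [t * b * r `^ d / 2]. *)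
Definition level_ratio : R := ((n.+1%:R `^ d)^-1 / 2)%R.

Lemma level_ratio_gt0 : (0 < level_ratio)%R.
Proof. by rewrite divr_gt0// invr_gt0 powR_gt0. Qed.

(** The first summand pays for the points where some potential is large, the second for the
    fractional maximal function at the level [t'] of the proof below. *)
Definition weak_constant : R :=
  ((fc^-1 `^ s) / level_ratio +
    (K * 16 `^ d * (3 ^ n)%:R) * (2 `^ s * 2 / b))%R.

Lemma weak_constant_gt0 : (0 < weak_constant)%R.
Proof.
apply: addr_gt0.
  by rewrite divr_gt0 ?level_ratio_gt0// powR_gt0// invr_gt0 far_constant_gt0.
by rewrite !mulr_gt0 ?invr_gt0// ?powR_gt0// ltr0n expn_gt0.
Qed.

(** [E u] will be the superlevel set of the function at [u]; the argument uses its monotonicity in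
    [u]. *)
Lemma riesz_cap_weak_type (E : R -> set 'rV[R]_n) (t : R) :
  (forall u v, (u <= v)%R -> E v `<=` E u) -> (0 < t)%R ->
  cap [set x | exists2 r, (0 < r)%R & (t * b * r `^ d)%:E <
         \int[lebesgue_measure]_(u in `]0%R, +oo[) cap (E u `&` eball x r)] <=
  (weak_constant / t)%:E *
  \sum_(k <oo) (2 ^+ k * (level_ratio * t))%:E * cap (E (2 ^+ k * (level_ratio * t))%R).
Proof.
move=> E_noninc t0; set X := [set x | _].
set sigma := (level_ratio * t)%R.
pose w k : R := (2 ^+ k * sigma)%R.
have sigma0 : (0 < sigma)%R by rewrite mulr_gt0// level_ratio_gt0.
have w0 k : (0 < w k)%R by rewrite mulr_gt0// exprn_gt0.
have cap0 A : 0 <= cap A by exact: riesz_cap_ge0.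
have wcap0 k : 0 <= (w k)%:E * cap (E (w k)) by rewrite mule_ge0 ?lee_fin ?(ltW (w0 k)).
set S := \sum_(k <oo) _.
have S0 : 0 <= S by apply: nneseries_ge0 => k _ _; exact: wcap0.
have C0 : (0 < weak_constant / t)%R by rewrite divr_gt0// weak_constant_gt0.
have [Soo|Sfin] := eqVneq S +oo; first by rewrite Soo gt0_muley ?leey ?lte_fin.
have capfin k : cap (E (w k)) < +oo.
  rewrite ltey; apply: contra Sfin => /eqP Ek; apply/eqP.
  apply: (@eseries_pinfty _ _ xpredT k) => //.
    by move=> i _; rewrite gt_eqF// (lt_le_trans _ (wcap0 i))// ltNye.
  by rewrite -/(w k) Ek gt0_muley// lte_fin.
apply/lee_addgt0Pr => e' e'0.
pose e := (e' / (weak_constant / t))%R.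
have e0 : (0 < e)%R by rewrite divr_gt0.
suff : cap X <= (weak_constant / t)%:E * (S + e%:E).
  move=> /le_trans; apply; rewrite ge0_muleDr//; last by rewrite lee_fin ltW.
  by rewrite -EFinM /e [(weak_constant / t * _)%R]mulrC divfK// gt_eqF.
(* The error is divided by the weight [w k], so that the weighted errors add up to at most [e]. *)
have ek k : (0 < e / (2 ^ k.+1)%:R / w k)%R by rewrite divr_gt0 ?w0// divr_gt0// ltr0n expn_gt0.
have /choice[phi phiP] k : exists phi, admissible alpha (E (w k)) phi /\
    energy s phi <= cap (E (w k)) + (e / (2 ^ k.+1)%:R / w k)%:E.
  by have [phi ? ?] := riesz_cap_approx s_gt0 (ek k) (capfin k); exists phi.
have mphi k : measurable_fun setT (phi k) by have [[]] := phiP k.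
have phi0 k y : (0 <= phi k y)%R by have [[]] := phiP k.
have phis0 k y : 0 <= (phi k y `^ s)%:E by rewrite lee_fin powR_ge0.
have mphis k : measurable_fun setT (fun y => (phi k y `^ s)%:E).
  exact: measurable_powR_EFin.
have energyS : \sum_(k <oo) (w k)%:E * energy s (phi k) <= S + e%:E.
  apply: le_trans (epsilon_trick xpredT wcap0 (ltW e0)).
  apply: lee_nneseries => [k *|k _].
    by rewrite mule_ge0 ?energy_ge0// lee_fin ltW.
  apply: (@le_trans _ _ ((w k)%:E * (cap (E (w k)) + (e / (2 ^ k.+1)%:R / w k)%:E))).
    by apply: lee_wpmul2l; [rewrite lee_fin ltW|exact: (phiP k).2].
  rewrite ge0_muleDr//; last by rewrite lee_fin ltW.
  by rewrite -[X in _ + X]EFinM [(w k * _)%R]mulrC divfK// gt_eqF.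
(* The density [g] gathers the weighted energies of all levels into a single measure of total mass
   at most [S + e]. *)
pose g y := \sum_(k <oo) (w k)%:E * (phi k y `^ s)%:E.
have gk0 k y : 0 <= (w k)%:E * (phi k y `^ s)%:E by rewrite mule_ge0// lee_fin ltW.
have g0 y : 0 <= g y by exact: nneseries_ge0.
have mgk k : measurable_fun setT (fun y => (w k)%:E * (phi k y `^ s)%:E).
  exact: measurable_funeM.
have mg : measurable_fun setT g by exact: ge0_emeasurable_sum.
pose nu := density (lebesgue_rV n) mg g0.
have nuE A : measurable A ->
    nu A = \sum_(k <oo) (w k)%:E * \int[lebesgue_rV n]_(y in A) (phi k y `^ s)%:E.
  move=> mA; rewrite /nu /density integral_nneseries//; last first.
    by move=> k; exact: measurable_funTS.
  apply: eq_eseriesr => k _; rewrite ge0_integralZl//; first exact: measurable_funTS.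
  by rewrite lee_fin ltW.
have nuT : nu setT <= S + e%:E by rewrite nuE.
pose F := \bigcup_k [set x | fc%:E <= pot (phi k) x].
(* The factor [2] is the half spent on levels below [sigma]; the power of [2] is the loss in
   [riesz_cap_localisation]. *)
pose t' := (t * (b / (2 `^ s * 2)))%R.
have t'0 : (0 < t')%R by rewrite mulr_gt0// divr_gt0// mulr_gt0// powR_gt0.
pose G := [set x | exists2 r : R, (0 < r)%R &
  (t' * r `^ d)%:E < nu (cube x (2 * r)%R)].
have XFG : X `<=` F `|` G.
  move=> x [r r0 hx]; have [Fx|Fx] := pselect (F x); [by left|right].
  exists r => //.
  have small k : pot (phi k) x < fc%:E.
    by rewrite ltNge; apply/negP => kx; apply: Fx; exists k.
  pose h u := cap (E u `&` eball x r).
  have hn u v : (u <= v)%R -> h v <= h u.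
    by move=> uv; apply: le_riesz_cap => //; apply: setSI; exact: E_noninc.
  have hM u : h u <= (K * r `^ d)%:E.
    apply: le_trans (cap_cube x r0); apply: le_riesz_cap => // y [_].
    exact: eball_sub_cube.
  have M0 : 0 <= (K * r `^ d)%:E by rewrite lee_fin mulr_ge0 ?powR_ge0// ltW.
  have h0 u : 0 <= h u by exact: cap0.
  have := lt_le_trans hx (integral_le_dyadic_sum h0 hn sigma0 M0 hM).
  have : \sum_(k <oo) (w k)%:E * h (w k) <= (2 `^ s)%:E * nu (cube x (2 * r)%R).
    rewrite nuE; last exact: measurable_cube.
    rewrite -nneseriesZl; last first.
      move=> k _; rewrite mule_ge0 ?integral_ge0//.
      by rewrite lee_fin ltW.
    apply: lee_nneseries => [k *|k _].
      by rewrite mule_ge0// lee_fin ltW.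
    rewrite muleCA; apply: lee_wpmul2l; first by rewrite lee_fin ltW.
    exact: (riesz_cap_localisation alpha_ltn s_gt0 r (phiP k).1 (small k)).
  rewrite -/sigma -/(w _) => /(leeD2l (sigma%:E * (K * r `^ d)%:E)) le1 /lt_le_trans/(_ le1){le1}.
  have -> : sigma%:E * (K * r `^ d)%:E = (t * b * r `^ d / 2)%:E.
    rewrite -EFinM /sigma /level_ratio /K; congr EFin; field.
    by rewrite gt_eqF// powR_gt0.
  have : 0 <= nu (cube x (2 * r)%R) by exact: measure_ge0.
  case: (nu _) => [v _| |//]; last by move=> *; exact: ltry.
  have p2 : (0 < 2 `^ s :> R)%R by exact: powR_gt0.
  rewrite -EFinM -EFinD !lte_fin => H.
  have -> : (t' * r `^ d = (t * b * r `^ d / 2) / 2 `^ s)%R.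
    by rewrite /t'; field; rewrite gt_eqF.
  by rewrite ltr_pdivrMr// mulrC; lra.
apply: (le_trans (le_riesz_cap alpha s_gt0 XFG)).
apply: (le_trans (riesz_capU alpha_ltn s_gt0 F G)).
have SE0 : 0 <= S + e%:E by rewrite adde_ge0 ?lee_fin ?(ltW e0).
have l0 := level_ratio_gt0.
have CF0 : (0 < fc^-1 `^ s / level_ratio / t)%R.
  by rewrite !divr_gt0// powR_gt0// invr_gt0 far_constant_gt0.
have CG0 : (0 < K * 16 `^ d * (3 ^ n)%:R / t')%R.
  by rewrite divr_gt0// !mulr_gt0 ?powR_gt0// ltr0n expn_gt0.
have capF : cap F <= (fc^-1 `^ s / level_ratio / t)%:E * (S + e%:E).
  apply: (le_trans (riesz_cap_sigma_subadditive alpha_ltn s_gt0 _)).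
  apply: (@le_trans _ _ ((fc^-1 `^ s / level_ratio / t)%:E *
      (\sum_(k <oo) (w k)%:E * energy s (phi k)))); last first.
    by apply: lee_wpmul2l => //; rewrite lee_fin ltW.
  rewrite -nneseriesZl; last first.
    by move=> k _; rewrite mule_ge0 ?energy_ge0// lee_fin ltW.
  apply: lee_nneseries => [k *|k _]; first exact: cap0.
  have := riesz_cap_superlevel alpha_ltn s_gt0 (@far_constant_gt0 R n alpha) (mphi k) (phi0 k).
  move=> /(_ [set x | fc%:E <= pot (phi k) x]) /(_ (fun=> id))/le_trans; apply.
  rewrite muleA -EFinM; apply: lee_wpmul2r; first exact: energy_ge0.
  (* Relative to [sigma] the weights are [2 ^+ k], at least [1], so weighted energies dominate the
     plain ones. *)
  rewrite lee_fin -mulrA -mulrA ler_peMr ?powR_ge0//.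
  have -> : (level_ratio^-1 / t * w k = 2 ^+ k)%R.
    by rewrite /w /sigma; field; rewrite !gt_eqF.
  by rewrite exprn_ege1// ler1n.
have capG : cap G <= (K * 16 `^ d * (3 ^ n)%:R / t')%:E * (S + e%:E).
  apply: (@le_trans _ _ ((K * 16 `^ d * (3 ^ n)%:R / t')%:E * nu setT)).
    apply: fractional_maximal_weak_type => //.
    - exact: riesz_cap0.
    - by move=> ? ?; exact: le_riesz_cap.
    - by move=> ? ?; exact: riesz_cap_sigma_subadditiveS.
  by apply: lee_wpmul2l => //; rewrite lee_fin ltW.
apply: (le_trans (leeD capF capG)).
rewrite -ge0_muleDl; last 2 first.
- by rewrite lee_fin ltW.
- by rewrite lee_fin ltW.
rewrite -EFinD (_ : (_ + _ = weak_constant / t)%R)//.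
rewrite /weak_constant /t' mulrDl; congr (_ + _)%R; field.
by rewrite !gt_eqF// powR_gt0.
Qed.

End weak_type.

(** * The capacitary maximal function and its two bounds *)

Section choquet_integral.
Context {R : realType} {n : nat}.
Implicit Types (D : set 'rV[R]_n) (f : 'rV[R]_n -> R).
Local Open Scope ereal_scope.

Lemma nneseries_geometric (z : R) : (0 <= z < 1)%R ->
  \sum_(k <oo) (z ^+ k)%:E = (1 - z)^-1%:E.
Proof.
move=> /andP[z0 z1].
have cz : series (geometric 1 z) @ \oo --> ((1 - z)^-1)%R.
  by rewrite -[(1 - z)^-1%R]mul1r; apply: cvg_geometric_series; rewrite ger0_norm.
have -> : (1 - z)^-1%:E = (limn (series (geometric 1 z)))%:E by rewrite (cvg_lim _ cz).
rewrite -EFin_lim; last exact: cvgP cz.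
congr (limn _); apply/funext => m /=; rewrite /series/= sumEFin.
by congr EFin; apply: eq_bigr => k _; rewrite mul1r.
Qed.

Lemma choquet_ge0 (c : set 'rV[R]_n -> \bar R) D g :
  (forall E, 0 <= c E) -> 0 <= choquet c D g.
Proof. by move=> c0; exact: integral_ge0. Qed.

Variables alpha s : R.
Hypotheses (alpha_ltn : (alpha < n%:R)%R) (s_gt0 : (0 < s)%R)
  (d_gt0 : (0 < n%:R - alpha * s)%R).
Local Notation cap := (@riesz_cap R n alpha s).

Definition superlevel D f (t : R) : set 'rV[R]_n := [set x | D x /\ (t < `|f x|)%R].

Lemma cap_maximal_ge0 D f x : 0 <= cap_maximal alpha s D f x.
Proof.
apply: (@le_trans _ _ ((cap (eball 0%R 1%R) * (1 `^ (n%:R - alpha * s))%:E)^-1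
      * choquet_on cap D (eball x 1%R) (fun y => `|f y|%:E))); last first.
  by apply: ereal_sup_ubound; exists 1%R => //=.
rewrite mule_ge0//; last by apply: choquet_ge0 => E; exact: riesz_cap_ge0.
by rewrite inve_ge0 mule_ge0 ?riesz_cap_ge0// lee_fin powR_ge0.
Qed.

(** The supremum yields a radius. At positive levels, cutting the function off outside the ball
    amounts to intersecting its superlevel sets with the ball. *)
Lemma cap_maximal_gt (b : R) D f x t : (0 < b)%R -> cap (eball 0%R 1%R) = b%:E ->
  t%:E < cap_maximal alpha s D f x ->
  exists2 r, (0 < r)%R & (t * b * r `^ (n%:R - alpha * s))%:E <
    \int[lebesgue_measure]_(u in `]0%R, +oo[) cap (superlevel D f u `&` eball x r).
Proof.
move=> b0 capB /ereal_sup_gt[_ [r /= r0 <-] tr]; exists r => //.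
have br0 : (0 < b * r `^ (n%:R - alpha * s))%R by rewrite mulr_gt0// powR_gt0.
move: tr; rewrite capB -EFinM inver gt_eqF// lte_pdivlMl//.
rewrite -EFinM mulrC mulrA => /lt_le_trans; apply.
rewrite /choquet_on /choquet le_eqVlt; apply/orP; left; apply/eqP.
apply: eq_integral => u; rewrite inE/= in_itv/= andbT => u0.
congr (riesz_cap _ _ _); apply/seteqP; split => y /=.
  move=> [Dy]; rewrite indicE; case: (boolP (y \in eball x r)) => [|_].
    by rewrite inE => By; rewrite mule1 lte_fin => uy; split.
  by rewrite mule0 lte_fin => /(lt_trans u0); rewrite ltxx.
by move=> [[Dy uy] By]; split => //; rewrite indicE mem_set// mule1 lte_fin.
Qed.

Lemma cap_maximal_weak_type : exists C theta : R, [/\ (0 < C)%R, (0 < theta)%R &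
  forall D f t, (0 < t)%R ->
    cap [set x | t%:E < cap_maximal alpha s D f x] <=
    (C / t)%:E * \sum_(k <oo) (2 ^+ k * (theta * t))%:E *
      cap (superlevel D f (2 ^+ k * (theta * t))%R)].
Proof.
have RHS0 D f t : (0 < t)%R -> 0 <= (1 / t)%:E * \sum_(k <oo) (2 ^+ k * (1 * t))%:E *
      cap (superlevel D f (2 ^+ k * (1 * t))%R).
  move=> t0; rewrite mule_ge0 ?lee_fin ?divr_ge0 ?(ltW t0)//.
  apply: nneseries_ge0 => k _ _; rewrite mule_ge0 ?riesz_cap_ge0// lee_fin.
  by rewrite mulr_ge0 ?exprn_ge0// mul1r ltW.
(* If the unit ball had infinite capacity, the normalizing factor would be [0] and the maximal
   function would vanish. *)
have [Boo|Bfin] := eqVneq (cap (eball 0%R 1%R)) +oo.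
  exists 1%R, 1%R; split => // D f t t0.
  rewrite (_ : [set x | _] = set0) ?riesz_cap0 ?RHS0//.
  apply/seteqP; split => // x /= /ereal_sup_gt[_ [r /= r0 <-]].
  rewrite Boo gt0_mulye ?lte_fin ?powR_gt0// invey mul0e lte_fin.
  by move=> /(lt_trans t0); rewrite ltxx.
have {}Bfin : cap (eball 0%R 1%R) \is a fin_num.
  by rewrite ge0_fin_numE ?riesz_cap_ge0// ltey.
pose b := fine (cap (eball 0%R 1%R)).
have capB : cap (eball 0%R 1%R) = b%:E by rewrite fineK.
have : (0 <= b)%R by rewrite fine_ge0 ?riesz_cap_ge0.
(* If the unit ball is null, every capacity is zero. *)
rewrite le_eqVlt => /predU1P[b0|b0].
  exists 1%R, 1%R; split => // D f t t0.
  by rewrite riesz_cap_eq0 ?RHS0// capB -b0.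
exists (@weak_constant R n alpha s b), (@level_ratio R n alpha s); split.
- exact: weak_constant_gt0.
- exact: level_ratio_gt0.
move=> D f t t0.
apply: le_trans (@riesz_cap_weak_type R n alpha s b alpha_ltn s_gt0 d_gt0 b0 capB
  (superlevel D f) t _ t0).
  apply: le_riesz_cap => // x /=; exact: cap_maximal_gt.
by move=> u v uv x [Dx vx]; split => //; exact: le_lt_trans vx.
Qed.

(** The dyadic sum is at most twice the Choquet integral, whatever its starting level
    [theta * t]. *)
Lemma cap_maximal_weak_type_1_1 : exists2 C : R, (0 < C)%R &
  forall D f t, (0 < t)%R ->
    cap [set x | t%:E < cap_maximal alpha s D f x] <=
    (C / t)%:E * choquet cap D (fun x => `|f x|%:E).
Proof.
have [C [theta [C0 theta0 weak]]] := cap_maximal_weak_type.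
exists (C * 2)%R; first by rewrite mulr_gt0.
move=> D f t t0; apply: (le_trans (weak D f t t0)).
rewrite [in leRHS]mulrAC [in leRHS]EFinM -[leRHS]muleA; apply: lee_wpmul2l; first by rewrite lee_fin divr_ge0// ltW.
apply: dyadic_sum_le_integral; last by rewrite mulr_gt0.
- by move=> u; exact: riesz_cap_ge0.
- move=> u v uv; apply: le_riesz_cap => // x [Dx vx]; split => //.
  exact: le_lt_trans vx.
Qed.

(** The weak bound is integrated over the levels and each term rescaled. The result is a geometric
    series of ratio [z], which is less than [1] because [p > 1]. *)
Lemma cap_maximal_strong_type (p : R) : (1 < p)%R -> exists2 C : R, (0 < C)%R &
  forall D f, choquet cap setT (fun x => cap_maximal alpha s D f x `^ p) <=
    C%:E * choquet cap D (fun x => (`|f x| `^ p)%:E).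
Proof.
move=> p1; have p0 : (0 < p)%R by rewrite (lt_trans _ p1).
have [C [theta [C0 theta0 weak]]] := cap_maximal_weak_type.
pose z : R := (2 `^ (1 - p))%R.
have z01 : (0 <= z < 1)%R.
  rewrite /z powR_ge0/= -opprB powRN invf_lt1 ?powR_gt0//.
  have : (1 `^ (p - 1) < 2 `^ (p - 1) :> R)%R.
    by apply: gt0_ltr_powR; rewrite ?nnegrE ?subr_gt0 ?ltr1n.
  by rewrite powR1.
have C'0 : (0 < C * theta `^ (1 - p) * (1 - z)^-1)%R.
  by rewrite !mulr_gt0 ?powR_gt0// invr_gt0 subr_gt0; case/andP: z01.
exists (C * theta `^ (1 - p) * (1 - z)^-1)%R => //.
move=> D f; pose M := cap_maximal alpha s D f.
pose H t := cap [set x | D x /\ t%:E < (`|f x| `^ p)%:E].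
have H0 t : 0 <= H t by exact: riesz_cap_ge0.
have Hn t u : (t <= u)%R -> H u <= H t.
  by move=> tu; apply: le_riesz_cap => // x [Dx ux]; split => //; exact: le_lt_trans ux.
(* If [t] is the power [p] of [u], the level [2 ^+ k * (theta * u)] of the modulus of [f] is the
   level [lam k * t] of its power. *)
pose lam k : R := ((2 ^+ k * theta) `^ p)%R.
have lam0 k : (0 < lam k)%R by rewrite powR_gt0// mulr_gt0// exprn_gt0.
have HM t : (0 < t)%R -> cap [set x | setT x /\ t%:E < M x `^ p] <=
    \sum_(k <oo) (C * theta * 2 ^+ k)%:E * H (lam k * t)%R.
  move=> t0; pose u := (t `^ p^-1)%R.
  have u0 : (0 < u)%R by exact: powR_gt0.
  have up : (u `^ p)%R = t by rewrite -powRrM mulVf ?gt_eqF// powRr1// ltW.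
  apply: (@le_trans _ _ (cap [set x | u%:E < M x])).
    apply: le_riesz_cap => // x /= [_]; rewrite !ltNge; apply: contra => xu.
    rewrite -up -poweR_EFin; apply: gt0_ler_poweR => //; first exact: ltW.
      by rewrite in_itv/= leey andbT cap_maximal_ge0.
    by rewrite in_itv/= leey andbT lee_fin ltW.
  apply: (le_trans (weak D f u u0)); rewrite -nneseriesZl; last first.
    move=> k _; rewrite mule_ge0 ?riesz_cap_ge0// lee_fin.
    by rewrite mulr_ge0 ?exprn_ge0// mulr_ge0// ltW.
  apply: lee_nneseries => [k _ _|k _].
    rewrite mule_ge0 ?lee_fin ?divr_ge0 ?(ltW C0) ?(ltW u0)//.
    rewrite mule_ge0 ?riesz_cap_ge0// lee_fin.
    by rewrite mulr_ge0 ?exprn_ge0// mulr_ge0// ltW.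
  rewrite muleA -EFinM.
  have -> : (C / u * (2 ^+ k * (theta * u)) = C * theta * 2 ^+ k)%R.
    by field; rewrite gt_eqF.
  apply: lee_wpmul2l; first by rewrite lee_fin !mulr_ge0 ?exprn_ge0// ltW.
  apply: le_riesz_cap => // x [Dx xu]; split => //; rewrite lte_fin.
  have -> : (lam k * t = (2 ^+ k * (theta * u)) `^ p)%R.
    by rewrite mulrA powRM ?(ltW u0) ?up// mulr_ge0 ?exprn_ge0 ?(ltW theta0).
  apply: gt0_ltr_powR => //; rewrite nnegrE//.
  by rewrite mulr_ge0 ?exprn_ge0// mulr_ge0// ltW.
have mH : measurable_fun setT H by exact: measurable_nonincreasing.
have Hlam k : measurable_fun setT (fun t => H (lam k * t)%R).
  by apply: (measurable_nonincreasing (h := fun t => H (lam k * t)%R)) => // t u tu;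
    apply: Hn; rewrite ler_pM2l.
have mHk k : measurable_fun setT (fun t => (C * theta * 2 ^+ k)%:E * H (lam k * t)%R).
  exact: measurable_funeM.
have Hk0 k t : 0 <= (C * theta * 2 ^+ k)%:E * H (lam k * t)%R.
  by rewrite mule_ge0// lee_fin !mulr_ge0 ?exprn_ge0// ltW.
have mS : measurable_fun setT (fun t => \sum_(k <oo) (C * theta * 2 ^+ k)%:E * H (lam k * t)%R).
  exact: ge0_emeasurable_sum.
pose J := \int[lebesgue_measure]_(t in `]0%R, +oo[) H t.
have J0 : 0 <= J by exact: integral_ge0.
rewrite -[X in _ <= _ * X]/J; have [->|Joo] := eqVneq J +oo.
  by rewrite gt0_muley ?leey// lte_fin.
apply: (@le_trans _ _ (\int[lebesgue_measure]_(t in `]0%R, +oo[)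
    \sum_(k <oo) (C * theta * 2 ^+ k)%:E * H (lam k * t)%R)).
  apply: ge0_le_integral => //.
  - by move=> t _; exact: riesz_cap_ge0.
  - apply: (measurable_nonincreasing
      (h := fun t => cap [set x | setT x /\ t%:E < M x `^ p])) => // t u tu.
    by apply: le_riesz_cap => // x [_ ux]; split => //; exact: le_lt_trans ux.
  - exact: measurable_funTS mS.
  - by move=> t; rewrite /= in_itv/= andbT; exact: HM.
rewrite integral_nneseries//; last by move=> k; exact: measurable_funTS (mHk k).
rewrite (eq_eseriesr (g := fun k => ((C * theta `^ (1 - p))%:E * J) * (z ^+ k)%:E)); last first.
  move=> k _; rewrite ge0_integralZl//; last 2 first.
  - exact: measurable_funTS (Hlam k).
  - by rewrite lee_fin !mulr_ge0 ?exprn_ge0// ltW.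
  rewrite /J (ge0_integral_itv0y_scale (lam0 k) H0 mH).
  (* The weight is split so that [lam k] is absorbed by the change of variables and the geometric
     factor remains. *)
  have -> : (C * theta * 2 ^+ k = C * theta `^ (1 - p) * lam k * z ^+ k)%R.
    have -> : (z ^+ k = (2 ^+ k) `^ (1 - p))%R.
      by rewrite /z -!powR_mulrn ?powR_ge0// -!powRrM mulrC.
    have k0 : (0 < 2 ^+ k * theta :> R)%R by rewrite mulr_gt0// exprn_gt0.
    have E : ((2 ^+ k) `^ (1 - p) * theta `^ (1 - p) * lam k = 2 ^+ k * theta :> R)%R.
      rewrite -powRM ?exprn_ge0 ?(ltW theta0)// /lam -powRD ?subrK ?powRr1 ?(ltW k0)//.
      by rewrite (gt_eqF k0) implybT.
    by rewrite -!mulrA [(theta * _)%R]mulrC -E; ring.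
  by rewrite muleAC [in RHS]muleA -!EFinM; congr (_%:E * _); ring.
have Jfin : J \is a fin_num by rewrite ge0_fin_numE// ltey.
rewrite -(fineK Jfin) -EFinM nneseriesZl; last first.
  by move=> k _; rewrite lee_fin exprn_ge0//; case/andP: z01.
by rewrite nneseries_geometric// -!EFinM mulrAC.
Qed.

End choquet_integral.

Unset Implicit Arguments.

Theorem theorem1p6 (R : realType) (n : nat) (alpha s p : R)
  (alpha_gt0 : 0 < alpha) (alpha_ltn : alpha < n%:R)
  (s_gt1 : 1 < s) (s_lt : s < n%:R / alpha) (p_ge1 : 1 <= p) :
  (1 < p -> exists2 C : R, 0 < C &
    forall (D : set 'rV[R]_n) (f : 'rV[R]_n -> R), Lp_cap alpha s p D f ->
      (choquet (riesz_cap alpha s) setT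
         (fun x => cap_maximal alpha s D f x `^ p)
       <= C%:E * choquet (riesz_cap alpha s) D (fun x => (`|f x| `^ p)%:E))%E)
  /\
  (p = 1 -> exists2 C : R, 0 < C &
    forall (D : set 'rV[R]_n) (f : 'rV[R]_n -> R), Lp_cap alpha s 1 D f ->
      forall t : R, 0 < t ->
      (riesz_cap alpha s [set x | t%:E < cap_maximal alpha s D f x]
       <= (C / t)%:E * choquet (riesz_cap alpha s) D (fun x => `|f x|%:E))%E).
Proof.
have s_gt0 : 0 < s by rewrite (lt_trans _ s_gt1).
have d_gt0 : 0 < n%:R - alpha * s.
  by rewrite subr_gt0 mulrC -ltr_pdivlMr.
split=> [p_gt1|_].
  have [C C0 CP] := cap_maximal_strong_type alpha_ltn s_gt0 d_gt0 p_gt1.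
  by exists C => // D f _; exact: CP.
have [C C0 CP] := cap_maximal_weak_type_1_1 alpha_ltn s_gt0 d_gt0.
by exists C => // D f _; exact: CP.
Qed.
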